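(* Let $A$ be a preprojective $\mathbb{C}$-algebra associated to a Euclidean diagram. Then $HH^2(A)\neq 0$.
   Context: A Euclidean diagram is an extended Dynkin diagram, that is, a graph of type $\widetilde{A}_n$ ($n\ge 1$), $\widetilde{D}_n$ ($n\ge4$), $\widetilde{E}_6$, $\widetilde{E}_7$ or $\widetilde{E}_8$. Preprojective algebra: let $Q$ be a finite quiver and $\hat Q$ the quiver with vertex set $Q_0$ and arrow set $Q_1\cup Q_1^{op}$, where $Q^{op}$ is the opposite quiver and $\hat\alpha$ denotes the arrow of $Q^{op}$ corresponding to $\alpha\in Q_1$. The preprojective $\mathbb{C}$-algebra of $Q$ is $\mathbb{C}\hat Q/I$, where $I$ is the two-sided ideal generated by $\sum_{\alpha\in Q_1}(\alpha\hat\alpha-\hat\alpha\alpha)$. Up to isomorphism it depends only on the underlying graph of $Q$; the preprojective algebra associated to a diagram is that of any quiver with this underlying graph. $HH^2(A)=\mathrm{Ext}^2_{A^e}(A,A)$ is the second Hochschild cohomology group, with $A^e=A\otimes_{\mathbb{C}}A^{op}$. *)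

(* Defs.v *)
From HB Require Import structures.
From mathcomp Require Import all_boot all_algebra.
From mathcomp Require Import finmap.
From mathcomp.classical Require Import boolp functions.
From mathcomp Require Import reals complex.
From mathcomp Require Import monalg.

Set Implicit Arguments.
Unset Strict Implicit.
Unset Printing Implicit Defensive.

Import GRing.Theory.
Local Open Scope ring_scope.

(* Linear extension of a map from the basis [B] of the free module
   [{malg S[B]}]. *)
Section Lift.
Variables (S : nzRingType) (B : choiceType) (V : lmodType S).

Definition malg_lift (f : B -> V) (g : {malg S[B]}) : V :=
  \sum_(b <- msupp g) g@_b *: f b.

Lemma malg_liftw (f : B -> V) (d : {fset B}) (g : {malg S[B]}) :
  fsubset (msupp g) d -> malg_lift f g = \sum_(b <- d) g@_b *: f b.
Proof.
move=> le; rewrite /malg_lift (big_fset_incl _ le) //= => b _ /mcoeff_outdom ->.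
by rewrite scale0r.
Qed.

Fact malg_lift_is_linear f : linear (malg_lift f).
Proof.
move=> k g h; pose d := fsetU (msupp g) (msupp h).
have lg : fsubset (msupp g) d by apply: fsubsetUl.
have lh : fsubset (msupp h) d by apply: fsubsetUr.
have lk : fsubset (msupp (k *: g + h)) d.
  apply: fsubset_trans (msuppD_le _ _) _; apply: fsetSU.
  exact: msuppZ_le.
rewrite (malg_liftw _ lk) (malg_liftw _ lg) (malg_liftw _ lh) scaler_sumr.
rewrite -big_split /=; apply: eq_bigr => b _.
by rewrite mcoeffD mcoeffZ scalerDl scalerA.
Qed.

HB.instance Definition _ f :=
  GRing.isLinear.Build S {malg S[B]} V *:%R (malg_lift f)
    (malg_lift_is_linear f).

Lemma malg_liftU f b : malg_lift f << b >> = f b.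
Proof.
by rewrite /malg_lift msuppU oner_eq0 big_seq_fset1 mcoeffUU scale1r.
Qed.

End Lift.

Lemma malg_ind (S : nzRingType) (B : choiceType) (P : {malg S[B]} -> Prop) :
  P 0 -> (forall k g h, P g -> P h -> P (k *: g + h)) ->
  (forall b, P << b >>) -> forall g, P g.
Proof.
move=> P0 Pl PU g; rewrite (monalgE g).
elim/big_ind: _ => // [x y Px Py|b _].
  by rewrite -[x]scale1r; apply: Pl.
have -> : << g@_b *g b >> = g@_b *: << b >> + 0 :> {malg S[B]}.
  by apply/malgP => c; rewrite !mcoeffsE addr0 mulrnAr mulr1.
exact: Pl.
Qed.

(* A partial monoid with finitely many local units, that is, the set of
   morphisms of a small category with finitely many objects; [pmul] is [None]
   on non-composable pairs. *)
Record pmonoid := PMonoid {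
  pm_sort :> choiceType;
  pmul : pm_sort -> pm_sort -> option pm_sort;
  punits : seq pm_sort;
  pmulA : forall x y z,
    obind (pmul x) (pmul y z) = obind (fun t => pmul t z) (pmul x y);
  pmul1l : forall x, pmap (fun e => pmul e x) punits = [:: x];
  pmul1r : forall x, pmap (pmul x) punits = [:: x];
  punits_uniq : uniq punits;
  punits_neq0 : punits != [::]
}.

(* The algebra with basis [B], the product of two non-composable basis elements
   being zero. *)
Definition palg (K : fieldType) (B : pmonoid) : Type := {malg K[B]}.

HB.instance Definition _ (K : fieldType) (B : pmonoid) :=
  GRing.Lmodule.copy (palg K B) {malg K[B]}.

HB.lock Definition pbasis (K : fieldType) (B : pmonoid) (b : B) : palg K B :=
  << b >>.
Arguments pbasis {K B} b.

Definition pmulU (K : fieldType) (B : pmonoid) (b c : B) : palg K B :=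
  oapp pbasis 0 (pmul b c).

HB.lock Definition palg_mul (K : fieldType) (B : pmonoid) (g h : palg K B) :
  palg K B := malg_lift (fun b => malg_lift (pmulU K b) h) g.

Section PAlg.
Variables (K : fieldType) (B : pmonoid).
Local Notation kB := (palg K B).

Definition palg_one : kB := \sum_(e <- punits B) pbasis e.

Lemma palg_ind (P : kB -> Prop) :
  P 0 -> (forall k g h, P g -> P h -> P (k *: g + h)) ->
  (forall b, P (pbasis b)) -> forall g, P g.
Proof.
move=> P0 Pl PU; apply: malg_ind => // b.
by have := PU b; rewrite pbasis.unlock.
Qed.

Fact palg_mulPl k (g1 g2 h : kB) :
  palg_mul (k *: g1 + g2) h = k *: palg_mul g1 h + palg_mul g2 h.
Proof. by rewrite palg_mul.unlock malg_lift_is_linear. Qed.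

Fact palg_mulPr k (g h1 h2 : kB) :
  palg_mul g (k *: h1 + h2) = k *: palg_mul g h1 + palg_mul g h2.
Proof.
elim/palg_ind: g => [|l g1 g2 IH1 IH2|b].
- by rewrite palg_mul.unlock !linear0 addr0.
- rewrite !palg_mulPl IH1 IH2 !scalerDr !scalerA [k * l]mulrC.
  exact: addrACA.
- by rewrite palg_mul.unlock pbasis.unlock !malg_liftU malg_lift_is_linear.
Qed.

Fact palg_mulUU (b c : B) : palg_mul (pbasis b) (pbasis c) = pmulU K b c.
Proof. by rewrite palg_mul.unlock pbasis.unlock !malg_liftU. Qed.

Fact palg_mul0g (g : kB) : palg_mul 0 g = 0.
Proof. by rewrite palg_mul.unlock linear0. Qed.

Fact palg_mulg0 (g : kB) : palg_mul g 0 = 0.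
Proof. by have:= palg_mulPr (-1) g 0 0; rewrite scaler0 addr0 scaleN1r addNr. Qed.

Fact palg_mulDl : left_distributive (@palg_mul K B) +%R.
Proof.
by move=> g1 g2 h; have := palg_mulPl 1 g1 g2 h; rewrite !scale1r.
Qed.

Fact palg_mulDr : right_distributive (@palg_mul K B) +%R.
Proof.
by move=> h g1 g2; have := palg_mulPr 1 h g1 g2; rewrite !scale1r.
Qed.

Fact palg_mulA : associative (@palg_mul K B).
Proof.
move=> f g h; elim/palg_ind: f => [|k f1 f2 IH1 IH2|a].
- by rewrite !palg_mul0g.
- by rewrite !palg_mulPl IH1 IH2.
elim/palg_ind: g => [|k g1 g2 IH1 IH2|b].
- by rewrite !(palg_mul0g, palg_mulg0).
- by rewrite !(palg_mulPl, palg_mulPr) IH1 IH2.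
elim/palg_ind: h => [|k h1 h2 IH1 IH2|c].
- by rewrite !palg_mulg0.
- by rewrite !palg_mulPr IH1 IH2.
rewrite !palg_mulUU /pmulU; have := pmulA a b c.
case: (pmul b c) (pmul a b) => [x|] [y|] /=.
- by rewrite !palg_mulUU /pmulU => ->.
- by rewrite palg_mulUU /pmulU palg_mul0g => ->.
- by rewrite palg_mulUU /pmulU palg_mulg0 => <-.
- by rewrite palg_mulg0 palg_mul0g.
Qed.

Fact big_pmap_unit (f : B -> option B) (s : seq B) :
  \sum_(e <- s) oapp pbasis 0 (f e) = \sum_(x <- pmap f s) pbasis x :> kB.
Proof.
elim: s => [|e s IH] /=; first by rewrite !big_nil.
by rewrite big_cons IH; case: (f e) => [x|] /=; rewrite ?big_cons ?add0r.
Qed.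

Fact palg_mul1g : left_id palg_one (@palg_mul K B).
Proof.
elim/palg_ind => [|k g1 g2 IH1 IH2|b]; first exact: palg_mulg0.
  by rewrite palg_mulPr IH1 IH2.
rewrite /palg_one (big_morph (fun g : kB => palg_mul g _) (fun x y : kB => palg_mulDl x y _)
  (palg_mul0g _)).
under eq_bigr do rewrite palg_mulUU.
by rewrite (big_pmap_unit (fun e => pmul e b)) pmul1l big_seq1.
Qed.

Fact palg_mulg1 : right_id palg_one (@palg_mul K B).
Proof.
elim/palg_ind => [|k g1 g2 IH1 IH2|b]; first exact: palg_mul0g.
  by rewrite palg_mulPl IH1 IH2.
rewrite /palg_one (big_morph (fun g : kB => palg_mul _ g) (fun x y : kB => palg_mulDr _ x y)
  (palg_mulg0 _)).
under eq_bigr do rewrite palg_mulUU.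
by rewrite (big_pmap_unit (pmul b)) pmul1r big_seq1.
Qed.

Fact palg_one_neq0 : palg_one != 0.
Proof.
apply/eqP/malgP; case E: (punits B) (punits_neq0 B) (punits_uniq B) => [|e s] //.
move=> _ /andP[es _] /(_ e); rewrite /palg_one E big_cons pbasis.unlock mcoeffD mcoeffUU.
rewrite raddf_sum big_seq big1 ?addr0 => [|x xs].
  by rewrite mcoeff0 => /eqP; rewrite oner_eq0.
rewrite /= mcoeffU; case: eqP => // xe; by rewrite xe (negPf es) in xs.
Qed.

HB.instance Definition _ := GRing.Zmodule_isNzRing.Build kB
  palg_mulA palg_mul1g palg_mulg1 palg_mulDl palg_mulDr palg_one_neq0.

Fact palg_scaleAl (k : K) (u v : kB) : k *: (u * v) = (k *: u) * v.
Proof.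
by have := palg_mulPl k u 0 v; rewrite palg_mul0g !addr0.
Qed.

HB.instance Definition _ := GRing.Lmodule_isLalgebra.Build K kB palg_scaleAl.

Fact palg_scaleAr (k : K) (u v : kB) : k *: (u * v) = u * (k *: v).
Proof.
by have := palg_mulPr k u v 0; rewrite palg_mulg0 !addr0.
Qed.

HB.instance Definition _ := GRing.Lalgebra_isAlgebra.Build K kB palg_scaleAr.

Lemma pbasisM (b c : B) : pbasis b * pbasis c = pmulU K b c.
Proof. exact: palg_mulUU. Qed.

End PAlg.

Record two_sided_ideal (A : nzRingType) (J : A -> Prop) : Prop := TwoSidedIdeal {
  ideal0 : J 0;
  idealB : forall x y, J x -> J y -> J (x - y);
  idealMl : forall a x, J x -> J (a * x);
  idealMr : forall a x, J x -> J (x * a)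
}.

Definition ideal_gen (A : nzRingType) (G : A -> Prop) (x : A) : Prop :=
  forall J : A -> Prop, two_sided_ideal J -> (forall g, G g -> J g) -> J x.

Lemma ideal_gen_ideal (A : nzRingType) (G : A -> Prop) :
  two_sided_ideal (ideal_gen G).
Proof.
split=> [J [J0 JB Jl Jr] GJ|x y Ix Iy J tJ GJ|a x Ix J tJ GJ|a x Ix J tJ GJ] //.
- by apply: (idealB tJ); [apply: Ix | apply: Iy].
- by apply: (idealMl tJ); apply: Ix.
- by apply: (idealMr tJ); apply: Ix.
Qed.

Lemma ideal_gen_sub (A : nzRingType) (G : A -> Prop) g : G g -> ideal_gen G g.
Proof. by move=> Gg J _; apply. Qed.

Definition ideal_pred (A : nzRingType) (G : A -> Prop) : {pred A} :=
  fun x => `[< ideal_gen G x >].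

Fact ideal_pred_closed (A : nzRingType) (G : A -> Prop) :
  zmod_closed (ideal_pred G).
Proof.
split=> [|x y /asboolP Ix /asboolP Iy]; apply/asboolP.
  exact: (ideal0 (ideal_gen_ideal G)).
exact: (idealB (ideal_gen_ideal G)).
Qed.

HB.instance Definition _ (A : nzRingType) (G : A -> Prop) :=
  GRing.isZmodClosed.Build A (ideal_pred G) (ideal_pred_closed G).

(* The quotient of [A] by the two-sided ideal generated by [G]; mathcomp's
   algebras being nonzero, the algebra structure needs this ideal proper. *)
Definition quot_alg (K : fieldType) (A : algType K) (G : A -> Prop)
  (G1 : ~ ideal_gen G 1) : Type := Quotient.quot (ideal_pred G).

Section QuotAlg.
Local Open Scope quotient_scope.
Variables (K : fieldType) (A : algType K) (G : A -> Prop).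
Hypothesis G1 : ~ ideal_gen G 1.
Local Notation Q := (quot_alg G1).

HB.instance Definition _ := GRing.Zmodule.on Q.
HB.instance Definition _ := Quotient.on Q.

Definition quot_pi (x : A) : Q := \pi_(Quotient.quot (ideal_pred G)) x.

Lemma quot_pi_eq x y : quot_pi x = quot_pi y <-> ideal_gen G (x - y).
Proof.
rewrite /quot_pi; split=> [/eqP|h]; first by rewrite -Quotient.idealrBE => /asboolP.
by apply/eqP; rewrite -Quotient.idealrBE; apply/asboolP.
Qed.

Lemma quot_pi_surj (q : Q) : exists x, quot_pi x = q.
Proof. by exists (repr q); rewrite /quot_pi reprK. Qed.

Fact quot_pi_is_zmod_morphism : zmod_morphism quot_pi.
Proof. by move=> x y; rewrite /quot_pi -[RHS]/(_ - _) !raddfB. Qed.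

Definition quot_mul (p q : Q) : Q := quot_pi (repr p * repr q).
Definition quot_scale (k : K) (p : Q) : Q := quot_pi (k *: repr p).

Fact quot_piN x : quot_pi (- x) = - quot_pi x.
Proof. by rewrite /quot_pi raddfN. Qed.
Fact quot_piD x y : quot_pi (x + y) = quot_pi x + quot_pi y.
Proof. by rewrite /quot_pi raddfD. Qed.

Fact quot_piM x y : quot_mul (quot_pi x) (quot_pi y) = quot_pi (x * y).
Proof.
apply/quot_pi_eq; set x' := repr _; set y' := repr _.
have ex : ideal_gen G (x' - x) by apply/quot_pi_eq; rewrite /quot_pi reprK.
have ey : ideal_gen G (y' - y) by apply/quot_pi_eq; rewrite /quot_pi reprK.
have -> : x' * y' - x * y = (x' - x) * y' - x * (- (y' - y)).
  by rewrite mulrN opprK mulrBr mulrBl addrA addrNK.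
have I := ideal_gen_ideal G; apply: (idealB I); first exact: (idealMr I).
apply: (idealMl I); rewrite -[- _]add0r; apply: (idealB I) => //.
exact: (ideal0 I).
Qed.

Fact quot_piZ k x : quot_scale k (quot_pi x) = quot_pi (k *: x).
Proof.
apply/quot_pi_eq; set x' := repr _.
have ex : ideal_gen G (x' - x) by apply/quot_pi_eq; rewrite /quot_pi reprK.
rewrite -scalerBr -[x' - x]mul1r scalerAl.
exact: (idealMl (ideal_gen_ideal G)).
Qed.

Fact quot_mulA : associative quot_mul.
Proof.
move=> p q r; have [x <-] := quot_pi_surj p; have [y <-] := quot_pi_surj q.
by have [z <-] := quot_pi_surj r; rewrite !quot_piM mulrA.
Qed.

Fact quot_mul1q : left_id (quot_pi 1) quot_mul.
Proof. by move=> p; have [x <-] := quot_pi_surj p; rewrite quot_piM mul1r. Qed.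

Fact quot_mulq1 : right_id (quot_pi 1) quot_mul.
Proof. by move=> p; have [x <-] := quot_pi_surj p; rewrite quot_piM mulr1. Qed.

Fact quot_mulDl : left_distributive quot_mul +%R.
Proof.
move=> p q r; have [x <-] := quot_pi_surj p; have [y <-] := quot_pi_surj q.
by have [z <-] := quot_pi_surj r; rewrite -quot_piD !quot_piM -quot_piD mulrDl.
Qed.

Fact quot_mulDr : right_distributive quot_mul +%R.
Proof.
move=> r p q; have [x <-] := quot_pi_surj p; have [y <-] := quot_pi_surj q.
by have [z <-] := quot_pi_surj r; rewrite -quot_piD !quot_piM -quot_piD mulrDr.
Qed.

Fact quot_one_neq0 : quot_pi 1 != 0.
Proof.
apply/eqP => e; apply: G1; rewrite -[1]subr0; apply/quot_pi_eq.
by rewrite e /quot_pi raddf0.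
Qed.

HB.instance Definition _ := GRing.Zmodule_isNzRing.Build Q
  quot_mulA quot_mul1q quot_mulq1 quot_mulDl quot_mulDr quot_one_neq0.

Fact quot_scaleA (a b : K) (p : Q) :
  quot_scale a (quot_scale b p) = quot_scale (a * b) p.
Proof. by have [x <-] := quot_pi_surj p; rewrite !quot_piZ scalerA. Qed.

Fact quot_scale1 : left_id 1 quot_scale.
Proof. by move=> p; have [x <-] := quot_pi_surj p; rewrite quot_piZ scale1r. Qed.

Fact quot_scaleDr : right_distributive quot_scale +%R.
Proof.
move=> k p q; have [x <-] := quot_pi_surj p; have [y <-] := quot_pi_surj q.
by rewrite -quot_piD !quot_piZ -quot_piD scalerDr.
Qed.

Fact quot_scaleDl p : {morph quot_scale^~ p : a b / a + b}.
Proof.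
by move=> a b /=; have [x <-] := quot_pi_surj p; rewrite !quot_piZ -quot_piD scalerDl.
Qed.

HB.instance Definition _ := GRing.Zmodule_isLmodule.Build K Q
  quot_scaleA quot_scale1 quot_scaleDr quot_scaleDl.

Fact quot_scaleAl (k : K) (p q : Q) : k *: (p * q) = (k *: p) * q.
Proof.
have [x <-] := quot_pi_surj p; have [y <-] := quot_pi_surj q.
rewrite -[LHS]/(quot_scale _ (quot_mul _ _)) -[RHS]/(quot_mul (quot_scale _ _) _).
by rewrite quot_piZ !quot_piM quot_piZ scalerAl.
Qed.

HB.instance Definition _ := GRing.Lmodule_isLalgebra.Build K Q quot_scaleAl.

Fact quot_scaleAr (k : K) (p q : Q) : k *: (p * q) = p * (k *: q).
Proof.
have [x <-] := quot_pi_surj p; have [y <-] := quot_pi_surj q.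
rewrite -[LHS]/(quot_scale _ (quot_mul _ _)) -[RHS]/(quot_mul _ (quot_scale _ _)).
by rewrite quot_piZ !quot_piM quot_piZ scalerAr.
Qed.

HB.instance Definition _ := GRing.Lalgebra_isAlgebra.Build K Q quot_scaleAr.

HB.instance Definition _ := GRing.isZmodMorphism.Build A Q quot_pi
  quot_pi_is_zmod_morphism.

Fact quot_pi_is_monoid_morphism : monoid_morphism quot_pi.
Proof. by split=> // x y; rewrite -[RHS]/(quot_mul _ _) quot_piM. Qed.

HB.instance Definition _ := GRing.isMonoidMorphism.Build A Q quot_pi
  quot_pi_is_monoid_morphism.

Fact quot_pi_is_scalable : scalable quot_pi.
Proof. by move=> k x; rewrite -[RHS]/(quot_scale _ _) quot_piZ. Qed.

HB.instance Definition _ := GRing.isScalable.Build K A Q *:%R quot_pi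
  quot_pi_is_scalable.

End QuotAlg.

(* The enveloping algebra [A (x)_K A^op]: the algebra over [K] of the monoid
   [A x A^op], modulo the relations making [(a, b)] bilinear. *)
Section Env.
Variables (K : fieldType) (A : algType K).

Definition env_mul (p q : A * A) : option (A * A) :=
  Some (p.1 * q.1, q.2 * p.2).

Fact env_mulA x y z : obind (env_mul x) (env_mul y z) =
  obind (fun t => env_mul t z) (env_mul x y).
Proof. by rewrite /env_mul /= !mulrA. Qed.
Fact env_mul1l x : pmap (fun e => env_mul e x) [:: (1, 1)] = [:: x].
Proof. by case: x => a b /=; rewrite mul1r mulr1. Qed.
Fact env_mul1r x : pmap (env_mul x) [:: (1, 1)] = [:: x].
Proof. by case: x => a b /=; rewrite mul1r mulr1. Qed.

Definition env_monoid : pmonoid :=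
  PMonoid env_mulA env_mul1l env_mul1r isT isT.

Local Notation KAA := (palg K env_monoid).
Definition pre_tensor (a b : A) : KAA := @pbasis K env_monoid (a, b).

Inductive bilinear_rel : KAA -> Prop :=
| BilinDl a a' b :
    bilinear_rel (pre_tensor (a + a') b - pre_tensor a b - pre_tensor a' b)
| BilinDr a b b' :
    bilinear_rel (pre_tensor a (b + b') - pre_tensor a b - pre_tensor a b')
| BilinZl k a b :
    bilinear_rel (pre_tensor (k *: a) b - k *: pre_tensor a b)
| BilinZr k a b :
    bilinear_rel (pre_tensor a (k *: b) - k *: pre_tensor a b).

(* [(a, b)] acts on [A] by [x |-> a x b]. *)
Definition pre_act (z : KAA) (x : A) : A :=
  malg_lift (fun p : env_monoid => p.1 * x * p.2) z.

Fact pre_actP k z t x : pre_act (k *: z + t) x = k *: pre_act z x + pre_act t x.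
Proof. exact: malg_lift_is_linear. Qed.

Fact pre_act0 x : pre_act 0 x = 0.
Proof. by rewrite /pre_act linear0. Qed.

Fact pre_actB z t x : pre_act (z - t) x = pre_act z x - pre_act t x.
Proof. by rewrite /pre_act linearB. Qed.

Fact pre_actD z t x : pre_act (z + t) x = pre_act z x + pre_act t x.
Proof. by rewrite /pre_act linearD. Qed.

Fact pre_actZ k z x : pre_act (k *: z) x = k *: pre_act z x.
Proof. by rewrite -[_ *: _ in LHS]addr0 pre_actP pre_act0 addr0. Qed.

Fact pre_act_tensor a b x : pre_act (pre_tensor a b) x = a * x * b.
Proof. by rewrite /pre_act /pre_tensor pbasis.unlock malg_liftU. Qed.

Fact pre_actDr z : {morph pre_act z : x y / x + y}.
Proof.
move=> x y; elim/palg_ind: z => [|k z t IHz IHt|[a b]].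
- by rewrite !pre_act0 addr0.
- by rewrite !pre_actP IHz IHt scalerDr addrACA.
- by rewrite !pre_act_tensor mulrDr mulrDl.
Qed.

Fact pre_actBr z : {morph pre_act z : x y / x - y}.
Proof.
move=> x y; apply: (canRL (addrK _)).
by rewrite -pre_actDr subrK.
Qed.

Fact pre_actZr z k x : pre_act z (k *: x) = k *: pre_act z x.
Proof.
elim/palg_ind: z => [|l z t IHz IHt|[a b]].
- by rewrite !pre_act0 scaler0.
- by rewrite !pre_actP IHz IHt scalerDr !scalerA mulrC.
- by rewrite !pre_act_tensor -scalerAr -scalerAl.
Qed.

Fact pre_actr0 z : pre_act z 0 = 0.
Proof. by rewrite -[in LHS](subrr 0) pre_actBr subrr. Qed.

Fact pre_actM z t x : pre_act (z * t) x = pre_act z (pre_act t x).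
Proof.
elim/palg_ind: z => [|k z z' IHz IHz'|[a b]].
- by rewrite mul0r !pre_act0.
- by rewrite mulrDl -scalerAl !pre_actP IHz IHz'.
elim/palg_ind: t => [|k t t' IHt IHt'|[c d]].
- by rewrite mulr0 !pre_act0 pre_actr0.
- have -> : pre_tensor a b * (k *: t + t') =
      k *: (pre_tensor a b * t) + pre_tensor a b * t' by exact: palg_mulPr.
  apply: etrans (pre_actP _ _ _ _) _.
  apply: etrans (congr2 +%R (congr1 ( *:%R k) IHt) IHt') _.
  rewrite -pre_actZr -pre_actDr; congr (pre_act _ _).
  exact/esym/pre_actP.
by rewrite pbasisM !pre_act_tensor !mulrA.
Qed.

Fact pre_act1 x : pre_act 1 x = x.
Proof.
have -> : 1 = pre_tensor 1 1 by rewrite -[LHS]/(palg_one _ _) /palg_one big_seq1.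
by rewrite pre_act_tensor mul1r mulr1.
Qed.

Fact pre_act_rel z : ideal_gen bilinear_rel z -> forall x, pre_act z x = 0.
Proof.
move/(_ (fun z => forall x, pre_act z x = 0)); apply.
  split=> [|u v Iu Iv x|a u Iu x|a u Iu x]; first exact: pre_act0.
  - by rewrite pre_actB Iu Iv subrr.
  - by rewrite pre_actM Iu pre_actr0.
  - by rewrite pre_actM Iu.
move=> _ [a a' b|a b b'|k a b|k a b] x;
  rewrite !pre_actB ?pre_actZ !pre_act_tensor.
- by rewrite !mulrDl addrAC addrK subrr.
- by rewrite !mulrDr addrAC addrK subrr.
- by rewrite -!scalerAl subrr.
- by rewrite -scalerAr subrr.
Qed.

Fact bilinear_rel_proper : ~ ideal_gen bilinear_rel 1.
Proof.
by move/pre_act_rel/(_ 1)/eqP; rewrite pre_act1 oner_eq0.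
Qed.

Definition env : algType K := quot_alg bilinear_rel_proper.

Definition tensor (a b : A) : env := quot_pi _ (pre_tensor a b).

End Env.

(* [A] as a left [env A]-module, i.e. as a bimodule over itself. *)
Definition bimod (K : fieldType) (A : algType K) : Type := A.

HB.instance Definition _ (K : fieldType) (A : algType K) :=
  GRing.Zmodule.on (bimod A).

HB.lock Definition env_act (K : fieldType) (A : algType K)
  (z : env A) (x : bimod A) : bimod A := pre_act (repr z) x.

Section EnvModule.
Variables (K : fieldType) (A : algType K).
Implicit Types (z t : env A) (x y : bimod A).

Fact env_act_pi u x : env_act (quot_pi (@bilinear_rel_proper K A) u) x = pre_act u x.
Proof.
rewrite env_act.unlock; apply/eqP; rewrite -subr_eq0 -pre_actB.
apply/eqP/pre_act_rel/(quot_pi_eq (@bilinear_rel_proper K A)).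
by rewrite /quot_pi reprK.
Qed.

Fact env_actA z t x : env_act z (env_act t x) = env_act (z * t) x.
Proof.
have [u <-] := quot_pi_surj z; have [v <-] := quot_pi_surj t.
by rewrite -rmorphM !env_act_pi pre_actM.
Qed.

Fact env_act1 : left_id 1 (@env_act K A).
Proof. by move=> x; rewrite -(rmorph1 (quot_pi _)) env_act_pi pre_act1. Qed.

Fact env_actDr : right_distributive (@env_act K A) +%R.
Proof. by move=> z x y; rewrite env_act.unlock; apply: pre_actDr. Qed.

Fact env_actDl x : {morph (fun z : env A => env_act z x) : z t / z + t}.
Proof.
move=> z t /=; have [u <-] := quot_pi_surj z; have [v <-] := quot_pi_surj t.
by rewrite -rmorphD !env_act_pi pre_actD.
Qed.

HB.instance Definition _ := GRing.Zmodule_isLmodule.Build (env A) (bimod A)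
  env_actA env_act1 env_actDr env_actDl.

Lemma env_scaleE (a b : A) x : tensor a b *: x = a * x * b :> A.
Proof. by rewrite -[LHS]/(env_act _ _) env_act_pi pre_act_tensor. Qed.

End EnvModule.

(* Ext over a ring, by the standard free resolution
     ... -> F(Omega^2 M) -> F(Omega M) -> F(M) -> M -> 0,
   where [F(N)] is free on the underlying set of [N] and [Omega N] is the kernel
   of the canonical surjection from [F(N)] to [N]. *)
Section Ext.
Variable S : nzRingType.

Section Cover.
Variable M : lmodType S.

Definition free_cover : lmodType S := {malg S[M]}.
Definition cover : {linear free_cover -> M} := malg_lift (id : M -> M).

Definition cover_kernel : {pred free_cover} := fun x => cover x == 0.

Fact cover_kernel_closed : submod_closed cover_kernel.
Proof.
split=> [|a x y]; rewrite /cover_kernel /in_mem /= ?linear0 //.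
by move=> /eqP ex /eqP ey; rewrite malg_lift_is_linear ex ey scaler0 addr0.
Qed.

HB.instance Definition _ :=
  GRing.isSubmodClosed.Build S free_cover cover_kernel cover_kernel_closed.

Record Omega_type := OmegaElt {
  Omega_val :> free_cover; _ : Omega_val \in cover_kernel }.

HB.instance Definition _ := [isSub for Omega_val].
HB.instance Definition _ := [Choice of Omega_type by <:].
HB.instance Definition _ := [SubChoice_isSubZmodule of Omega_type by <:].
HB.instance Definition _ := [SubZmodule_isSubLmodule of Omega_type by <:].

Definition Omega : lmodType S := Omega_type.

Lemma cover_surj x : exists y, cover y = x.
Proof. by exists << x >>; apply: malg_liftU. Qed.

Lemma cover_kernelP y : cover y = 0 <-> exists z : Omega, Omega_val z = y.
Proof.
split=> [/eqP h|[[z /= /eqP h] <-]] //; by exists (OmegaElt h).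
Qed.

(* Freeness, hence projectivity. *)
Lemma free_cover_lift (X Y : lmodType S) (p : {linear X -> Y})
    (f : {linear free_cover -> Y}) :
  (forall y, exists x, p x = y) ->
  exists h : {linear free_cover -> X}, forall u, p (h u) = f u.
Proof.
move=> ps; have [s sP] := choice (fun m : M => ps (f << m >>)).
exists (malg_lift s) => u.
elim/(@malg_ind S M): u => [|k g h IHg IHh|b]; first by rewrite !linear0.
  by rewrite !linearP IHg IHh.
by rewrite -sP; congr (p _); apply: malg_liftU.
Qed.

End Cover.

Section Resolution.
Variables M N : lmodType S.

Definition syzygy (n : nat) : lmodType S := iter n Omega M.
Definition res (n : nat) : lmodType S := free_cover (syzygy n).
Definition res_d (n : nat) : {linear res n.+1 -> res n} :=
  (val : Omega (syzygy n) -> res n) \o cover (syzygy n.+1).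

Lemma res_augE (x : res 0) : cover M x = 0 <-> exists y, x = res_d _ y.
Proof.
split=> [/cover_kernelP[z <-]|[y ->]]; last by apply/cover_kernelP; eexists.
by have [y <-] := cover_surj z; exists y.
Qed.

Lemma res_exact n (x : res n.+1) : res_d _ x = 0 <-> exists y, x = res_d _ y.
Proof.
have -> : res_d _ x = 0 <-> cover (syzygy n.+1) x = 0.
   rewrite -[res_d _ x]/(val (cover (syzygy n.+1) x)).
  by split=> [h|->] //; apply: val_inj.
split=> [/cover_kernelP[z <-]|[y ->]]; last by apply/cover_kernelP; eexists.
by have [y <-] := cover_surj z; exists y.
Qed.

Definition cocycle (n : nat) : {pred res n -> N} := fun f =>
  `[< linear f /\ forall x : res n.+1, f (res_d _ x) = 0 >].

Fact cocycle_closed n : zmod_closed (@cocycle n).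
Proof.
split=> [|f g /asboolP[lf f0] /asboolP[lg g0]]; apply/asboolP; split.
- by move=> a x y; rewrite /GRing.zero /= scaler0 addr0.
- by [].
- move=> a x y; rewrite !fctE lf lg scalerBr opprD.
  exact: addrACA.
- by move=> x; rewrite !fctE f0 g0 subrr.
Qed.

HB.instance Definition _ n :=
  GRing.isZmodClosed.Build (res n -> N) (@cocycle n) (@cocycle_closed n).

Record Z_ext (n : nat) := ZExt {
  Z_ext_val :> res n -> N; _ : Z_ext_val \in @cocycle n }.

HB.instance Definition _ n := [isSub for @Z_ext_val n].
HB.instance Definition _ n := [Choice of Z_ext n by <:].
HB.instance Definition _ n := [SubChoice_isSubZmodule of Z_ext n by <:].

Definition is_coboundary (n : nat) : (res n -> N) -> Prop :=
  match n with
  | 0 => fun f => forall x, f x = 0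
  | m.+1 => fun f =>
      exists2 g : res m -> N, linear g & forall x, f x = g (res_d _ x)
  end.

Definition coboundary (n : nat) : {pred Z_ext n} := fun f =>
  `[< is_coboundary (f : res n -> N) >].

Fact coboundary_closed n : zmod_closed (@coboundary n).
Proof.
case: n => [|n]; split=> [|f g /asboolP Bf /asboolP Bg]; apply/asboolP.
- by [].
- by move=> x; apply: etrans (congr2 (fun u v => u - v) (Bf x) (Bg x)) (subrr _).
- by exists 0 => // a x y; rewrite /GRing.zero /= scaler0 addr0.
- move: Bf Bg => [f' lf ef] [g' lg eg]; exists (f' - g').
    move=> a x y; rewrite !fctE lf lg scalerBr opprD; exact: addrACA.
  by move=> x; apply: (congr2 (fun u v => u - v) (ef x) (eg x)).
Qed.

HB.instance Definition _ n :=
  GRing.isZmodClosed.Build (Z_ext n) (@coboundary n) (@coboundary_closed n).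

Definition Ext (n : nat) : zmodType := Quotient.quot (@coboundary n).

End Resolution.
End Ext.

(* Hochschild cohomology, Ext^n_{A^e}(A, A). *)
Definition HH (n : nat) (K : fieldType) (A : algType K) : zmodType :=
  @Ext (env A) (bimod A) (bimod A) n.

(* Finite quivers, nonempty so that path algebras are nonzero. *)
Record quiver := Quiver {
  vertex : finType;
  arrow : finType;
  src : arrow -> vertex;
  tgt : arrow -> vertex;
  quiver_neq0 : (0 < #|vertex|)%N
}.
Arguments src {q} _.
Arguments tgt {q} _.

Section Path.
Variable Q : quiver.

Fixpoint walk (v : vertex Q) (s : seq (arrow Q)) : bool :=
  if s is a :: s' then (src a == v) && walk (tgt a) s' else true.

(* A path is its starting vertex with its sequence of arrows, listed in the
   order in which they are traversed. *)
Record qpath := QPath {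
  path_val : vertex Q * seq (arrow Q);
  path_walk : walk path_val.1 path_val.2 }.

HB.instance Definition _ := [isSub for path_val].
HB.instance Definition _ := [Choice of qpath by <:].

Definition path_src (p : qpath) : vertex Q := (val p).1.
Definition path_tgt (p : qpath) : vertex Q :=
  last (val p).1 (map tgt (val p).2).

Definition trivial_path (v : vertex Q) : qpath :=
  @QPath (v, [::]) isT.

Definition path_concat (p q : qpath) : option qpath :=
  if path_tgt p == path_src q
  then insub ((val p).1, (val p).2 ++ (val q).2) else None.

Fact walk_cat v s t :
  walk v (s ++ t) = walk v s && walk (last v (map tgt s)) t.
Proof. by elim: s v => //= a s IH v; rewrite IH andbA. Qed.

Fact path_concatP p q : path_tgt p = path_src q ->
  exists2 r, path_concat p q = Some r &
    val r = ((val p).1, (val p).2 ++ (val q).2).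
Proof.
move=> e; rewrite /path_concat e eqxx.
case: insubP => [r _ h|]; first by exists r.
by rewrite /= walk_cat (valP p) -/(path_tgt p) e (valP q).
Qed.

Fact path_concatN p q : path_tgt p != path_src q -> path_concat p q = None.
Proof. by rewrite /path_concat => /negPf->. Qed.

Fact path_concatA x y z :
  obind (path_concat x) (path_concat y z) =
  obind (fun t => path_concat t z) (path_concat x y).
Proof.
have [exy|nxy] := eqVneq (path_tgt x) (path_src y); last first.
  rewrite (path_concatN nxy) /=.
  have [eyz|nyz] := eqVneq (path_tgt y) (path_src z); last by rewrite path_concatN.
  have [r -> hr] /= := path_concatP eyz.
  by rewrite path_concatN // /path_src hr.
have [s es hs] := path_concatP exy; rewrite es /=.
have ets : path_tgt s = path_tgt y.
  by rewrite /path_tgt hs /= map_cat last_cat -/(path_tgt x) exy.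
have [eyz|nyz] := eqVneq (path_tgt y) (path_src z); last first.
  by rewrite !path_concatN ?ets.
have [r er hr] := path_concatP eyz; rewrite er /=.
have esr : path_src r = path_src y by rewrite /path_src hr.
have [u -> hu] := path_concatP (etrans exy (esym esr)).
have [v -> hv] := path_concatP (etrans ets eyz).
by congr Some; apply: val_inj; rewrite hu hv hs hr /= catA.
Qed.

Definition trivial_paths : seq qpath := [seq trivial_path v | v <- enum (vertex Q)].

Fact pmap_single (f : vertex Q -> option qpath) v x : f v = Some x ->
  (forall w, w != v -> f w = None) -> pmap f (enum (vertex Q)) = [:: x].
Proof.
move=> fv fN; have: v \in enum (vertex Q) by rewrite mem_enum.
elim: (enum _) (enum_uniq (vertex Q)) => //= w s IH /andP[ws us].
rewrite inE; case: eqVneq => [e _|nvw /= vs]; last by rewrite fN 1?eq_sym //= IH.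
rewrite -e fv /=; congr (_ :: _); rewrite -{}e in ws.
elim: s ws {IH us} => //= u s IH; rewrite inE negb_or => /andP[nu /IH e].
by rewrite (fN u) /= ?e // eq_sym.
Qed.

Fact pmap_map (T U V : Type) (f : U -> option V) (h : T -> U) s :
  pmap f (map h s) = pmap (fun v => f (h v)) s.
Proof. by elim: s => //= a s ->. Qed.

Fact path_concat1l x : pmap (fun e => path_concat e x) trivial_paths = [:: x].
Proof.
rewrite pmap_map; apply: (@pmap_single _ (path_src x)) => [|w nw].
  have [r -> hr] := @path_concatP (trivial_path (path_src x)) x erefl.
  by congr Some; apply: val_inj; rewrite hr; case: (x) => [[]].
by rewrite path_concatN.
Qed.

Fact path_concat1r x : pmap (path_concat x) trivial_paths = [:: x].
Proof.
rewrite pmap_map; apply: (@pmap_single _ (path_tgt x)) => [|w nw].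
  have [r -> hr] := @path_concatP x (trivial_path (path_tgt x)) erefl.
  by congr Some; apply: val_inj; rewrite hr /= cats0; case: (x) => [[]].
by rewrite path_concatN // eq_sym.
Qed.

Fact trivial_paths_uniq : uniq trivial_paths.
Proof. by rewrite map_inj_uniq ?enum_uniq // => v w []. Qed.

Fact trivial_paths_neq0 : trivial_paths != [::].
Proof. by rewrite -size_eq0 size_map -cardE -lt0n quiver_neq0. Qed.

Definition path_monoid : pmonoid :=
  PMonoid path_concatA path_concat1l path_concat1r
    trivial_paths_uniq trivial_paths_neq0.

Fact arrow_path_subproof (a : arrow Q) : walk (src a) [:: a].
Proof. by rewrite /= eqxx. Qed.

Definition arrow_path (a : arrow Q) : qpath :=
  @QPath (src a, [:: a]) (arrow_path_subproof a).

End Path.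

Definition path_alg (K : fieldType) (Q : quiver) : algType K :=
  palg K (path_monoid Q).

(* [inl a] is the arrow [a] of [Q], [inr a] the opposite arrow. *)
Definition double_quiver (Q : quiver) : quiver := {|
  vertex := vertex Q;
  arrow := (arrow Q + arrow Q)%type;
  src := fun a => match a with inl a => src a | inr a => tgt a end;
  tgt := fun a => match a with inl a => tgt a | inr a => src a end;
  quiver_neq0 := quiver_neq0 Q
|}.

Section Preprojective.
Variables (K : fieldType) (Q : quiver).
Local Notation P := (path_alg K (double_quiver Q)).

Definition alg_arrow (a : arrow (double_quiver Q)) : P :=
  @pbasis K (path_monoid (double_quiver Q)) (arrow_path a).

(* Products of paths are read from left to right. *)
Definition preproj_elt : P :=
  \sum_(a : arrow Q) (alg_arrow (inl a) * alg_arrow (inr a)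
                      - alg_arrow (inr a) * alg_arrow (inl a)).

Definition preproj_rel (x : P) : Prop := x = preproj_elt.

(* The coefficient of the trivial path at [v], a ring morphism. *)
Definition aug (v : vertex Q) (x : P) : K :=
  mcoeff (trivial_path (Q := double_quiver Q) v) (x : {malg K[_]}).

Fact augP v k x y : aug v (k *: x + y) = k * aug v x + aug v y.
Proof. by rewrite /aug mcoeffD mcoeffZ. Qed.

Fact augU v p : aug v (@pbasis K (path_monoid (double_quiver Q)) p) =
  (p == trivial_path (Q := double_quiver Q) v)%:R.
Proof. by rewrite pbasis.unlock /aug mcoeffU. Qed.

Fact augM v x y : aug v (x * y) = aug v x * aug v y.
Proof.
have aug0 : aug v 0 = 0 by rewrite /aug mcoeff0.
elim/palg_ind: x => [|k x x' IH IH'|p]; first by rewrite mul0r aug0 mul0r.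
  have -> : (k *: x + x') * y = k *: (x * y) + x' * y :> P by exact: palg_mulPl.
  by rewrite (augP v k (x * y)) IH IH' (augP v k x) mulrDl mulrA.
elim/palg_ind: y => [|k y y' IH IH'|q]; first by rewrite mulr0 aug0 mulr0.
  have -> : pbasis p * (k *: y + y') = k *: (pbasis p * y) + pbasis p * y' :> P.
    exact: palg_mulPr.
  by rewrite (augP v k (_ * y)) IH IH' (augP v k y) mulrDr mulrCA.
rewrite pbasisM !augU -natrM mulnb /pmulU /=.
have [e|n] := eqVneq (path_tgt p) (path_src q); last first.
  rewrite path_concatN //= aug0; case: eqP => [ep|//]; case: eqP => [eq|//].
  by rewrite ep eq eqxx in n.
have [r -> hr] := path_concatP e; rewrite /= augU; congr (nat_of_bool _)%:R.
apply/eqP/andP=> [er|[/eqP ep /eqP eq]]; last first.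
  by apply: val_inj; rewrite hr ep eq.
move: hr; rewrite er => -[ev es]; have [ep eq] : (val p).2 = [::] /\ (val q).2 = [::].
  by case: ((val p).2) es.
have ep1 : path_tgt p = (val p).1 by rewrite /path_tgt ep.
split; apply/eqP; apply: val_inj; rewrite [LHS]surjective_pairing.
  by rewrite ep ev.
by rewrite eq ev -ep1 e.
Qed.

Fact preproj_rel_proper : ~ ideal_gen preproj_rel 1.
Proof.
have /card_gt0P[v _] := quiver_neq0 Q.
have aug0 : aug v 0 = 0 by rewrite /aug mcoeff0.
have augB x y : aug v (x - y) = aug v x - aug v y by rewrite /aug mcoeffB.
have augA a : aug v (alg_arrow a) = 0.
  by rewrite augU; case: eqP => // /(congr1 (fun p => size (val p).2)).
have aug1 : aug v 1 = 1.
  pose e : P :=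
    @pbasis K (path_monoid (double_quiver Q)) (@trivial_path (double_quiver Q) v).
  have e1 : aug v e = 1 by rewrite augU eqxx.
  by have := augM v 1 e; rewrite mul1r e1 mulr1 => <-.
move=> /(_ (fun x => aug v x = 0)) h.
suff: aug v 1 = 0 by move/eqP; rewrite aug1 oner_eq0.
apply: h => [|_ ->].
  split=> [//|x y ex ey|a x ex|a x ex]; first by rewrite augB ex ey subrr.
    by rewrite augM ex mulr0.
  by rewrite augM ex mul0r.
rewrite /preproj_elt; elim/big_ind: _ => // [x y ex ey|a _].
  by rewrite -[x]scale1r augP ex ey mulr0 addr0.
by rewrite augB !augM !augA !mul0r subrr.
Qed.

Definition preproj_alg : algType K := quot_alg preproj_rel_proper.

End Preprojective.

(* [E] lists the endpoints of the edges (with multiplicities) of a graph on the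
   vertices [0, ..., n - 1]; the order of the two endpoints is irrelevant. *)
Definition underlying_graph (Q : quiver) (n : nat) (E : seq (nat * nat)) : Prop :=
  exists (f : vertex Q -> 'I_n) (g : arrow Q -> 'I_(size E)),
    [/\ bijective f, bijective g & forall a : arrow Q,
      let e := nth (0, 0)%N E (g a) in
      (nat_of_ord (f (src a)), nat_of_ord (f (tgt a))) = e \/
      (nat_of_ord (f (tgt a)), nat_of_ord (f (src a))) = e].

Inductive euclidean_diagram : nat -> seq (nat * nat) -> Prop :=
| Euclidean_A n : (1 <= n)%N ->
    euclidean_diagram n.+1 (rcons [seq (i, i.+1) | i <- iota 0 n] (n, 0))%N
| Euclidean_D n : (4 <= n)%N ->
    euclidean_diagram n.+1
      ([:: (0, 2); (1, 2)] ++ [seq (i, i.+1) | i <- iota 2 (n - 4)]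
       ++ [:: (n - 2, n - 1); (n - 2, n)])%N
| Euclidean_E6 :
    euclidean_diagram 7 [:: (0, 1); (1, 2); (0, 3); (3, 4); (0, 5); (5, 6)]%N
| Euclidean_E7 :
    euclidean_diagram 8
      [:: (0, 1); (1, 2); (2, 3); (0, 4); (4, 5); (5, 6); (0, 7)]%N
| Euclidean_E8 :
    euclidean_diagram 9
      [:: (0, 1); (1, 2); (2, 3); (3, 4); (4, 5); (0, 6); (6, 7); (0, 8)]%N.

Definition of_euclidean_type (Q : quiver) : Prop :=
  exists n E, euclidean_diagram n E /\ underlying_graph Q n E.

(* Main.v *)
From HB Require Import structures.
Require Import Defs.
From mathcomp Require Import all_boot all_algebra.
From mathcomp Require Import finmap.
From mathcomp Require Import reals complex.
From mathcomp.classical Require Import boolp classical_sets functions.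
From mathcomp Require Import monalg zify.

Set Implicit Arguments.
Unset Strict Implicit.
Unset Printing Implicit Defensive.

Import GRing.Theory.
Local Open Scope ring_scope.

(** Let P be the path algebra of the double quiver, rho = sum_b eps_b b b' the
    preprojective element (b' being the arrow opposite to b), I the ideal that
    it generates and A = P / I. The class that survives is that of the
    deformation rho = t with t^2 = 0: a map of P-bimodules D : I -> A with
    D rho = 1. If D were the restriction of a derivation d : P -> A, then
    1 = d rho = sum_b eps_b (d b * b' + b * d b') would lie in the ideal spanned
    by the arrows, which the augmentation at a vertex forbids. Any bimodule map
    on I that does not come from a derivation gives a Hochschild 2-cocycle that
    is not a coboundary ([HH2_neq0_of_ideal_map]), and comparing the standard
    free resolution with the bar resolution turns such a cocycle into a nonzero
    element of Ext^2 ([HH2_neq0_of_cocycle]).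

    The map D exists as soon as sum p_i rho q_i = 0 in P forces sum p_i q_i to
    lie in I. By induction on the degree, stripping last arrows, this follows
    from the absence of a right socle in A: if x b lies in I for every arrow b,
    then x lies in I ([socle_free], [relation_graph_functional]).

    The socle is where the diagram matters. Fix a vertex w and let V_m(v) be the
    degree m part of e_w A e_v. By the relations V_{m+2}(v) is the cokernel of
    the map from V_m(v) to the sum of the V_{m+1}(u), u running over the
    neighbours of v, and a socle element is a vector in the kernel of such a
    map. If z in V_m is the first one, then for a linear form l with l z = 1 the
    rank one map x |-> l(x) z of V_m extends by zero to V_{m+1}, and exactness
    lets it descend degree by degree to an endomorphism of the right module
    generated by V_0 = K e_w. There it must be a scalar, so V_m = K z and
    V_{m+1} = 0 ([brick_row]): this is the argument that reflection functors
    preserve bricks. On the other hand a Euclidean diagram carries a positive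
    weight delta whose sum over the neighbours of v is 2 delta(v)
    ([euclidean_delta]); with it, the inequality of Golod and Shafarevich makes
    the sequence sum_v delta(v) dim V_m(v) strictly increasing
    ([piece_growth]), so that V_{m+1} is never zero. *)

(** * Identities in abelian groups and vector spaces *)

Lemma linear_fun0 (K : fieldType) (V W : lmodType K) (f : V -> W) : linear f -> f 0 = 0.
Proof.
by move=> lf; have := lf (-1) 0 0; rewrite !scaleN1r oppr0 addr0 addNr.
Qed.

Lemma alternating_sum0 (V : zmodType) (p q r s : V) :
  p - q + r - s = 0 -> q = p - s + r.
Proof.
move=> e; apply/esym/eqP; rewrite -subr_eq0 -[X in _ == X]e.
by rewrite [_ - q]addrAC (addrAC p (- s)) (addrAC (p - q)).
Qed.

Lemma telescope3 (V : zmodType) (p q r : V) : p - q + (r - p + (q - r)) = 0.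
Proof. by rewrite (addrC (r - p)) (addrA (q - r)) subrK addrA subrK subrr. Qed.

Lemma alternating4 (V : zmodType) (p q r s : V) :
  p - q - (r - s) + (q - s) - (p - r) = 0.
Proof. by rewrite !opprB (addrAC (p - q)) !addrA !subrK subrr. Qed.

Lemma scaled_difference (K : fieldType) (V : lmodType K) (k c a b : K) (x y z : V) :
  c *: (k *: x + y) - (k * a + b) *: z = k *: (c *: x - a *: z) + (c *: y - b *: z).
Proof.
by rewrite scalerBr !scalerA addrACA -opprD -scalerDl scalerDr scalerA (mulrC k c).
Qed.

(** * Complements of subspaces *)

Section LinearComplement.
Variables (K : fieldType) (V : lmodType K) (J : V -> Prop).
Hypothesis J0 : J 0.
Hypothesis JP : forall k x y, J x -> J y -> J (k *: x + y).

Let JB x y : J x -> J y -> J (x - y).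
Proof. by move=> Jx Jy; rewrite addrC -scaleN1r; apply: JP. Qed.

(** By Zorn: a maximal subspace meeting [J] trivially is a complement of [J]. *)
Lemma complement_exists : exists C : V -> Prop,
  [/\ forall k x y, C x -> C y -> C (k *: x + y),
      forall x, C x -> J x -> x = 0 & forall x, exists2 c, C c & J (x - c)].
Proof.
(* [P] does not ask for 0, so that the empty chain has the empty union as an
   upper bound; [C0] below puts 0 back. *)
pose P (X : set V) := (forall k x y, X x -> X y -> X (k *: x + y)) /\
  (forall x, X x -> J x -> x = 0).
have [|C [[CP CJ] maxC]] := @Zorn_bigcup V P.
  move=> F FP totF; split=> [k x y [X FX Xx] [Y FY Yy]|x [X FX Xx]]; last first.
    exact: (FP X FX).2.
  have [XY|YX] := totF _ _ FX FY.
    by exists Y => //; apply: (FP Y FY).1 => //; apply: XY.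
  by exists X => //; apply: (FP X FX).1 => //; apply: YX.
pose C0 x := C x \/ x = 0.
have C0P k x y : C0 x -> C0 y -> C0 (k *: x + y).
  case=> [Cx|->]; case=> [Cy|->].
  - by left; apply: CP.
  - left; have := CP (k - 1) _ _ Cx Cx.
    by rewrite addr0 scalerBl scale1r subrK.
  - by left; rewrite scaler0 add0r.
  - by right; rewrite scaler0 add0r.
have C0J x : C0 x -> J x -> x = 0 by case=> [|->] //; apply: CJ.
exists C0; split=> // x; apply: contrapT => nx.
pose D u := exists k c, C0 c /\ u = k *: x + c.
have CD u : C0 u -> D u by move=> Cu; exists 0, u; rewrite scale0r add0r.
apply: (maxC D); split.
- by move=> u Cu; apply: CD; left.
- move=> DC; apply: nx; exists x; last by rewrite subrr.
  by left; apply: DC; exists 1, 0; split; [right|rewrite scale1r addr0].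
- move=> l _ _ [a [c [Cc ->]]] [b [d [Cd ->]]].
  exists (l * a + b), (l *: c + d); split; first exact: C0P.
  by rewrite scalerDr scalerA addrACA -scalerDl.
- move=> _ [a [c [Cc ->]]] Jac; case: (eqVneq a 0) Jac => [->|na] Jac.
    by move: Jac; rewrite scale0r add0r; apply: C0J.
  case: nx; exists (- a^-1 *: c + 0); first by apply: C0P => //; right.
  have -> : x - (- a^-1 *: c + 0) = a^-1 *: (a *: x + c) + 0.
    by rewrite !addr0 scalerDr scalerA mulVf // scale1r scaleNr opprK.
  exact: JP.
Qed.

(** The projection along [J] onto a complement. It serves both as a linear
    section of a quotient map and as a source of linear forms vanishing on [J]. *)
Lemma subspace_projection : exists p : {linear V -> V},
  (forall x, J (x - p x)) /\ (forall x, J x -> p x = 0).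
Proof.
have [C [CP CJ CV]] := complement_exists.
have [x|p pP] := @choice V V (fun x c => C c /\ J (x - c)).
  by have [c Cc Jc] := CV x; exists c.
have pE x c : C c -> J (x - c) -> p x = c.
  move=> Cc Jc; have [Cp Jp] := pP x; apply/eqP; rewrite -subr_eq0; apply/eqP.
  apply: CJ; first by rewrite addrC -scaleN1r; apply: CP.
  have -> : p x - c = (x - c) - (x - p x) by rewrite opprB [RHS]addrC addrA subrK.
  exact: JB.
have p_lin : linear p.
  move=> k x y; apply: pE; first by apply: CP; [case: (pP x)|case: (pP y)].
  rewrite opprD addrACA -scalerBr.
  by apply: JP; [case: (pP x)|case: (pP y)].
pose pl := GRing.isLinear.Build K V V *:%R p p_lin.
exists (HB.pack_for {linear V -> V} p pl); split=> x /=; first by case: (pP x).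
have [c Cc _] := CV 0.
have C0 : C 0 by have := CP (-1) _ _ Cc Cc; rewrite scaleN1r addNr.
by move=> Jx; apply: pE => //; rewrite subr0.
Qed.

End LinearComplement.

(** * The standard resolution and Hochschild cocycles *)

Section EnvLift.
Variables (K : fieldType) (A : algType K) (V : lmodType K).

Definition bilinear_map (f : A -> A -> V) : Prop :=
  (forall b, linear (fun a => f a b)) /\ (forall a, linear (f a)).

Definition pre_lift (f : A -> A -> V) (z : palg K (env_monoid A)) : V :=
  malg_lift (fun p : env_monoid A => f p.1 p.2) z.

Lemma pre_liftP f k z t :
  pre_lift f (k *: z + t) = k *: pre_lift f z + pre_lift f t.
Proof. exact: malg_lift_is_linear. Qed.

Lemma pre_lift0 f : pre_lift f 0 = 0.
Proof. by rewrite /pre_lift linear0. Qed.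

Lemma pre_liftB f z t : pre_lift f (z - t) = pre_lift f z - pre_lift f t.
Proof. by rewrite /pre_lift linearB. Qed.

Lemma pre_liftZ f k z : pre_lift f (k *: z) = k *: pre_lift f z.
Proof. by rewrite -[_ *: _ in LHS]addr0 pre_liftP pre_lift0 addr0. Qed.

Lemma pre_lift_tensor f a b : pre_lift f (pre_tensor a b) = f a b.
Proof. by rewrite /pre_lift /pre_tensor pbasis.unlock malg_liftU. Qed.

Lemma bilinear_mul f a b : bilinear_map f -> bilinear_map (fun x y => f (a * x) (y * b)).
Proof.
case=> fl fr; split=> [y k u v|x k u v].
  by rewrite mulrDr -scalerAr fl.
by rewrite mulrDl -scalerAl fr.
Qed.

Lemma pre_lift_mull f a b z : pre_lift f (pre_tensor a b * z) =
  pre_lift (fun x y => f (a * x) (y * b)) z.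
Proof.
elim/palg_ind: z => [|k z t IHz IHt|[x y]].
- by rewrite mulr0 !pre_lift0.
- have -> : pre_tensor a b * (k *: z + t) =
    k *: (pre_tensor a b * z) + pre_tensor a b * t by exact: palg_mulPr.
  by rewrite !pre_liftP IHz IHt.
- by rewrite pbasisM -!/(pre_tensor _ _) !pre_lift_tensor.
Qed.

Lemma pre_lift_mulr f a b z : pre_lift f (z * pre_tensor a b) =
  pre_lift (fun x y => f (x * a) (b * y)) z.
Proof.
elim/palg_ind: z => [|k z t IHz IHt|[x y]].
- by rewrite mul0r !pre_lift0.
- have -> : (k *: z + t) * pre_tensor a b =
    k *: (z * pre_tensor a b) + t * pre_tensor a b by exact: palg_mulPl.
  by rewrite !pre_liftP IHz IHt.
- by rewrite pbasisM -!/(pre_tensor _ _) !pre_lift_tensor.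
Qed.

(** Vanishing for all bilinear maps at once is an ideal condition, because
    multiplying the argument by a pure tensor only replaces the bilinear map by
    another one. *)
Lemma pre_lift_rel z : ideal_gen (@bilinear_rel K A) z ->
  forall f, bilinear_map f -> pre_lift f z = 0.
Proof.
move/(_ (fun z => forall f, bilinear_map f -> pre_lift f z = 0)); apply.
  split=> [|u v Iu Iv|c u Iu|c u Iu] f bf; first exact: pre_lift0.
  - by rewrite pre_liftB Iu ?Iv ?subrr.
  - elim/palg_ind: c => [|k x y IHx IHy|[a b]].
    + by rewrite mul0r pre_lift0.
    + have -> : (k *: x + y) * u = k *: (x * u) + y * u by exact: palg_mulPl.
      by rewrite pre_liftP IHx IHy scaler0 addr0.
    + by rewrite -/(pre_tensor a b) pre_lift_mull Iu //; apply: bilinear_mul.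
  - elim/palg_ind: c => [|k x y IHx IHy|[a b]].
    + by rewrite mulr0 pre_lift0.
    + have -> : u * (k *: x + y) = k *: (u * x) + u * y by exact: palg_mulPr.
      by rewrite pre_liftP IHx IHy scaler0 addr0.
    + rewrite -/(pre_tensor a b) pre_lift_mulr Iu //; case: bf => fl fr.
      split=> [y k x x'|x k y y']; first by rewrite mulrDl -scalerAl fl.
      by rewrite mulrDr -scalerAr fr.
move=> _ [a a' b|a b b'|k a b|k a b] f [fl fr];
  rewrite !pre_liftB ?pre_liftZ !pre_lift_tensor.
- by have := fl b 1 a a'; rewrite !scale1r => ->; rewrite addrAC addrK subrr.
- by have := fr a 1 b b'; rewrite !scale1r => ->; rewrite addrAC addrK subrr.
- have fb0 : f 0 b = 0 := linear_fun0 (fl b).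
  by have := fl b k a 0; rewrite !addr0 fb0 addr0 => ->; rewrite subrr.
- have fa0 : f a 0 = 0 := linear_fun0 (fr a).
  by have := fr a k b 0; rewrite !addr0 fa0 addr0 => ->; rewrite subrr.
Qed.

Definition env_lift (f : A -> A -> V) (z : env A) : V := pre_lift f (repr z).

Lemma env_lift_pi f u : bilinear_map f ->
  env_lift f (quot_pi (@bilinear_rel_proper K A) u) = pre_lift f u.
Proof.
move=> bf; apply/eqP; rewrite -subr_eq0 -pre_liftB; apply/eqP/pre_lift_rel => //.
by apply/(quot_pi_eq (@bilinear_rel_proper K A)); rewrite /quot_pi reprK.
Qed.

Lemma env_lift_tensor f a b : bilinear_map f -> env_lift f (tensor a b) = f a b.
Proof. by move=> bf; rewrite env_lift_pi // pre_lift_tensor. Qed.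

Lemma env_lift_linear f : bilinear_map f -> linear (env_lift f).
Proof.
move=> bf k z t; have [u <-] := quot_pi_surj z; have [v <-] := quot_pi_surj t.
by rewrite -linearP !env_lift_pi // pre_liftP.
Qed.
End EnvLift.

Section EnvInd.
Variables (K : fieldType) (A : algType K).

Lemma env_ind (P : env A -> Prop) : P 0 ->
  (forall k s t, P s -> P t -> P (k *: s + t)) ->
  (forall a b, P (tensor a b)) -> forall s, P s.
Proof.
move=> P0 PP Pt s; have [u <-] := quot_pi_surj s.
elim/palg_ind: u => [|k z t IHz IHt|[a b]]; first by rewrite linear0.
  by rewrite linearP; apply: PP.
exact: Pt.
Qed.

Lemma tensorM (a b c d : A) : tensor a b * tensor c d = tensor (a * c) (d * b).
Proof. by rewrite /tensor -rmorphM /pre_tensor pbasisM. Qed.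

Lemma tensor11 : tensor 1 1 = 1 :> env A.
Proof.
rewrite -(rmorph1 (quot_pi (@bilinear_rel_proper K A))) /tensor; congr quot_pi.
by rewrite -[RHS]/(palg_one _ _) /palg_one big_seq1.
Qed.

Lemma tensorPl (b : A) : linear (fun a => tensor a b).
Proof.
move=> k a a'; rewrite /tensor -linearP; apply/quot_pi_eq.
have I := ideal_gen_ideal (@bilinear_rel K A).
have -> : pre_tensor (k *: a + a') b - (k *: pre_tensor a b + pre_tensor a' b) =
    (pre_tensor (k *: a + a') b - pre_tensor (k *: a) b - pre_tensor a' b) -
    - (pre_tensor (k *: a) b - k *: pre_tensor a b).
  by rewrite opprK opprD [in RHS]addrAC !addrA addrNK addrAC.
apply: (idealB I); first by apply: ideal_gen_sub; exact: BilinDl.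
rewrite -[- _]add0r; apply: (idealB I); first exact: (ideal0 I).
by apply: ideal_gen_sub; exact: BilinZl.
Qed.

Lemma tensorPr (a : A) : linear (tensor a).
Proof.
move=> k b b'; rewrite /tensor -linearP; apply/quot_pi_eq.
have I := ideal_gen_ideal (@bilinear_rel K A).
have -> : pre_tensor a (k *: b + b') - (k *: pre_tensor a b + pre_tensor a b') =
    (pre_tensor a (k *: b + b') - pre_tensor a (k *: b) - pre_tensor a b') -
    - (pre_tensor a (k *: b) - k *: pre_tensor a b).
  by rewrite opprK opprD [in RHS]addrAC !addrA addrNK addrAC.
apply: (idealB I); first by apply: ideal_gen_sub; exact: BilinDr.
rewrite -[- _]add0r; apply: (idealB I); first exact: (ideal0 I).
by apply: ideal_gen_sub; exact: BilinZr.
Qed.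
End EnvInd.

(** A name of its own for the generators of a free cover keeps them apart from
    the other uses of free modules. *)
Definition free_gen (S : nzRingType) (L : lmodType S) (x : L) : free_cover L := << x >>.

Lemma cover_free_gen (S : nzRingType) (L : lmodType S) (x : L) :
  Defs.cover L (free_gen x) = x.
Proof. exact: malg_liftU. Qed.

Section HH2.
Variables (K : fieldType) (A : algType K) (c : A -> A -> A).
Hypothesis c_bilin : bilinear_map c.
Hypothesis c_cocycle : forall x y z,
  x * c y z - c (x * y) z + c x (y * z) - c x y * z = 0.

Local Notation S := (env A).
Local Notation M := (bimod A).

(** The composite of a lifting to the bar resolution with the cocycle: if
    t = sum x_i (x) y_i is killed by the multiplication, then it is, up to sign,
    the boundary of sum x_i (x) y_i (x) 1; the contracting homotopy followed by
    [c] sends the multiple of the latter by a (x) b to sum c (a x_i) y_i b. *)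
Definition bar_pairing (s t : S) : A :=
  env_lift (fun a b => env_lift (fun x y => c (a * x) y * b) t) s.

Lemma bar_pairing_inner a b : bilinear_map (fun x y => c (a * x) y * b).
Proof.
case: c_bilin => cl cr; split=> [y k u v|x k u v].
  by rewrite mulrDr -scalerAr cl mulrDl -scalerAl.
by rewrite cr mulrDl -scalerAl.
Qed.

Lemma bar_pairing_outer t :
  bilinear_map (fun a b => env_lift (fun x y => c (a * x) y * b) t).
Proof.
case: (c_bilin) => cl cr; split=> [b k u v|a k u v].
  elim/env_ind: t => [|l s t IHs IHt|x y].
  - have e0 a b' : env_lift (fun x y => c (a * x) y * b') 0 = 0.
      have := env_lift_linear (bar_pairing_inner a b') (-1) 0 0.
      by rewrite !scaleN1r oppr0 addr0 addNr.
    by rewrite !e0 scaler0 addr0.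
  - rewrite !(env_lift_linear (bar_pairing_inner _ _)) IHs IHt !scalerDr !scalerA.
    by rewrite [k * l]mulrC addrACA.
  - rewrite !(env_lift_tensor _ _ (bar_pairing_inner _ _)).
    by rewrite mulrDl -scalerAl cl mulrDl -scalerAl.
elim/env_ind: t => [|l s t IHs IHt|x y].
- have e0 a' b' : env_lift (fun x y => c (a' * x) y * b') 0 = 0.
    have := env_lift_linear (bar_pairing_inner a' b') (-1) 0 0.
    by rewrite !scaleN1r oppr0 addr0 addNr.
  by rewrite !e0 scaler0 addr0.
- rewrite !(env_lift_linear (bar_pairing_inner _ _)) IHs IHt !scalerDr !scalerA.
  by rewrite [k * l]mulrC addrACA.
- rewrite !(env_lift_tensor _ _ (bar_pairing_inner _ _)).
  by rewrite mulrDr -scalerAr.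
Qed.

Lemma bar_pairingPl t : linear (fun s => bar_pairing s t).
Proof. exact/env_lift_linear/bar_pairing_outer. Qed.

Lemma bar_pairing_tensorl a b t :
  bar_pairing (tensor a b) t = env_lift (fun x y => c (a * x) y * b) t.
Proof. exact: env_lift_tensor (bar_pairing_outer t). Qed.

Lemma bar_pairingPr s : linear (bar_pairing s).
Proof.
move=> k t t'; elim/env_ind: s => [|l s s' IHs IHt|a b].
- have e0 u : bar_pairing 0 u = 0.
    have := bar_pairingPl u (-1) 0 0.
    by rewrite !scaleN1r oppr0 addr0 addNr.
  by rewrite !e0 scaler0 addr0.
- rewrite !bar_pairingPl IHs IHt !scalerDr !scalerA.
  by rewrite [k * l]mulrC addrACA.
- by rewrite !bar_pairing_tensorl (env_lift_linear (bar_pairing_inner _ _)).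
Qed.

Lemma bar_pairing_tensor a b x y : bar_pairing (tensor a b) (tensor x y) = c (a * x) y * b.
Proof. by rewrite bar_pairing_tensorl env_lift_tensor //; apply: bar_pairing_inner. Qed.

Lemma bar_pairing0l t : bar_pairing 0 t = 0.
Proof. exact: linear_fun0 (bar_pairingPl t). Qed.

Lemma bar_pairing0r s : bar_pairing s 0 = 0.
Proof. exact: linear_fun0 (bar_pairingPr s). Qed.

Lemma bar_pairingZl k s t : bar_pairing (k *: s) t = k *: bar_pairing s t.
Proof. by rewrite -[k *: s]addr0 bar_pairingPl bar_pairing0l addr0. Qed.

Definition mult (s : S) : A := env_lift (fun x y => x * y) s.
Definition contraction (a b : A) (s : S) : A := env_lift (fun x y => c a x * y * b) s.

Lemma mult_bilin : bilinear_map (fun x y : A => x * y).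
Proof. by split=> [y k u v|x k u v]; rewrite ?mulrDl ?mulrDr -?scalerAl -?scalerAr. Qed.

Lemma contraction_bilin a b : bilinear_map (fun x y => c a x * y * b).
Proof.
case: c_bilin => cl cr; split=> [y k u v|x k u v].
  by rewrite cr !mulrDl -!scalerAl.
by rewrite mulrDr mulrDl -scalerAr -scalerAl.
Qed.

Lemma multP : linear mult.
Proof. exact: env_lift_linear mult_bilin. Qed.

Lemma contractionP a b : linear (contraction a b).
Proof. exact: env_lift_linear (contraction_bilin a b). Qed.

Lemma mult_tensor a b : mult (tensor a b) = a * b.
Proof. exact: env_lift_tensor mult_bilin. Qed.

Lemma contraction_tensor a b x y : contraction a b (tensor x y) = c a x * y * b.
Proof. exact: env_lift_tensor (contraction_bilin a b). Qed.

Lemma bar_pairing_equivariance_tensor a b x y t :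
  bar_pairing (tensor a b * tensor x y) t =
    a * bar_pairing (tensor x y) t * b - contraction a b (tensor x y * t)
    + c a (x * mult t) * y * b.
Proof.
have [cl cr] := c_bilin.
elim/env_ind: t => [|k t t' IHt IHt'|u v].
- by rewrite !bar_pairing0r !mulr0 mul0r (linear_fun0 multP) mulr0 (linear_fun0 (contractionP a b))
    (linear_fun0 (cr a)) !mul0r addr0 subrr.
- rewrite !bar_pairingPr IHt IHt' multP !mulrDr -!scalerAr cr !mulrDl -!scalerAl.
  by rewrite contractionP !scalerDr opprD scalerN (addrACA (k *: _)) (addrACA (k *: _ + _)).
- rewrite !tensorM !bar_pairing_tensor mult_tensor contraction_tensor.
  have := c_cocycle a (x * u) v => /(congr1 (fun z => z * y * b)) /eqP.
  by rewrite !mulrDl !mulNr !mul0r -!mulrA => /eqP /alternating_sum0.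
Qed.

(** The cocycle identity measures how far the pairing is from being linear over
    the enveloping algebra; the defect depends on the product s * t only. *)
Lemma bar_pairing_equivariance a b s t : mult t = 0 ->
  bar_pairing (tensor a b * s) t = a * bar_pairing s t * b - contraction a b (s * t).
Proof.
move=> t0; have [cl cr] := c_bilin.
elim/env_ind: s => [|k s s' IHs IHt|x y].
- by rewrite mulr0 bar_pairing0l mul0r mulr0 mul0r (linear_fun0 (contractionP a b)) subrr.
- rewrite mulrDr -scalerAr !bar_pairingPl IHs IHt.
  rewrite [(_ + s') * t]mulrDl -[k *: s * t]scalerAl contractionP mulrDr mulrDl -scalerAr -scalerAl.
  by rewrite scalerDr scalerN opprD addrACA.
- by rewrite bar_pairing_equivariance_tensor t0 mulr0 (linear_fun0 (cr a)) !mul0r addr0.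
Qed.

Lemma env_act_linear (x : M) : linear (fun s : S => env_act s x : A).
Proof.
move=> k s t; have [u <-] := quot_pi_surj s; have [v <-] := quot_pi_surj t.
by rewrite -linearP !env_act_pi pre_actP.
Qed.

Lemma mult_env_act s t : mult (s * t) = env_act s (mult t : M).
Proof.
elim/env_ind: s => [|k s s' IHs IHs'|a b].
- by rewrite mul0r (linear_fun0 multP) (linear_fun0 (env_act_linear _)).
- by rewrite mulrDl -scalerAl multP IHs IHs' (env_act_linear _).
rewrite -[RHS]/(tensor a b *: (_ : M)) env_scaleE.
elim/env_ind: t => [|k t t2 IHt IHt'|u0 v0].
- by rewrite mulr0 (linear_fun0 multP) mulr0 mul0r.
- by rewrite mulrDr -scalerAr !multP IHt IHt' mulrDr mulrDl -scalerAr -scalerAl.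
- by rewrite tensorM !mult_tensor !mulrA.
Qed.

(** The degree 0 comparison map from the standard resolution to the bar
    resolution. *)
Definition cover_env : {linear free_cover M -> S^o} :=
  malg_lift (fun x : M => tensor (x : A) 1 : S^o).

Lemma cover_env_free_gen (x : M) : cover_env (free_gen x) = tensor (x : A) 1.
Proof. exact: malg_liftU. Qed.

Lemma mult_cover_env (u : free_cover M) : mult (cover_env u) = Defs.cover M u.
Proof.
elim/malg_ind: u => [|s u v IHu IHv|x]; first by rewrite !linear0 (linear_fun0 multP).
  rewrite !linearP -[in RHS]IHu -[in RHS]IHv.
  have -> : mult (s *: cover_env u + cover_env v) = mult (s * cover_env u) + mult (cover_env v).
    by have := multP 1 (s * cover_env u) (cover_env v); rewrite !scale1r.
  by rewrite mult_env_act.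
rewrite cover_env_free_gen.
rewrite (cover_free_gen x).
by rewrite mult_tensor mulr1.
Qed.

(** The 2-cocycle [c] pulled back along the comparison map. It is additive, but
    linear over the enveloping algebra on syzygies only. *)
Definition cochain (g : free_cover (Omega M)) : A :=
  \sum_(w <- msupp g) bar_pairing g@_w (cover_env (Omega_val w)).

Lemma cochain_w (d : {fset Omega M}) (g : free_cover (Omega M)) :
  fsubset (msupp g) d ->
  cochain g = \sum_(w <- d) bar_pairing g@_w (cover_env (Omega_val w)).
Proof.
move=> le; rewrite /cochain (big_fset_incl _ le) //= => w _ /mcoeff_outdom ->.
exact: bar_pairing0l.
Qed.

Lemma cochainD g h : cochain (g + h) = cochain g + cochain h.
Proof.
pose d := fsetU (msupp g) (msupp h).
have lg : fsubset (msupp g) d by apply: fsubsetUl.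
have lh : fsubset (msupp h) d by apply: fsubsetUr.
rewrite (cochain_w (msuppD_le _ _)) (cochain_w lg) (cochain_w lh) -big_split /=.
apply: eq_bigr => w _; rewrite mcoeffD.
by have := bar_pairingPl (cover_env (Omega_val w)) 1 (g@_w) (h@_w); rewrite !scale1r.
Qed.

Lemma cochain0 : cochain 0 = 0.
Proof. by rewrite /cochain msupp0 big_seq_fset0. Qed.

Lemma cochainU s (w : Omega M) :
  cochain (s *: free_gen w) = bar_pairing s (cover_env (Omega_val w)).
Proof.
have le : fsubset (msupp (s *: free_gen w : free_cover (Omega M))) [fset w]%fset.
  by apply: fsubset_trans (msuppZ_le _ _) _; rewrite msuppU oner_eq0.
by rewrite (cochain_w le) big_seq_fset1 mcoeffZ mcoeffUU mulr1.
Qed.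

Lemma scale_free_gen (r s : S) (w : Omega M) : r *: (s *: free_gen w) = (r * s) *: free_gen w.
Proof. exact: scalerA. Qed.

(** Induction over sums of multiples of generators, for statements that are
    additive without being linear over the enveloping algebra. *)
Lemma malg_add_ind (P : free_cover (Omega M) -> Prop) : P 0 ->
  (forall g h, P g -> P h -> P (g + h)) ->
  (forall s w, P (s *: free_gen w)) -> forall g, P g.
Proof.
move=> P0 PD PU g; suff: forall s, P (s *: g) by move/(_ 1); rewrite scale1r.
elim/malg_ind: g => [|k g h IHg IHh|w] s; [by rewrite scaler0| |exact: PU].
by rewrite scalerDr scalerA; apply: PD.
Qed.

Lemma cochain_tensor a b (g : free_cover (Omega M)) :
  cochain (tensor a b *: g) = a * cochain g * b -
    contraction a b (cover_env (Omega_val (Defs.cover (Omega M) g))).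
Proof.
elim/malg_add_ind: g => [|g h IHg IHh|s w].
- rewrite scaler0 cochain0 !linear0 mulr0 mul0r.
  by rewrite (linear_fun0 (contractionP a b)) subrr.
- rewrite scalerDr; apply: etrans (cochainD _ _) _.
  apply: etrans (congr2 +%R IHg IHh) _.
  rewrite (cochainD g h) (linearD (Defs.cover (Omega M))).
  have -> (u v : Omega M) : cover_env (Omega_val (u + v)) =
    cover_env (Omega_val u) + cover_env (Omega_val v) by apply: (linearD cover_env).
  have -> (u v : S^o) : contraction a b (u + v) = contraction a b u + contraction a b v.
    by have := contractionP a b 1 u v; rewrite !scale1r.
  by rewrite mulrDr mulrDl opprD addrACA.
- rewrite scale_free_gen.
  rewrite [X in X = _](cochainU (tensor a b * s) w).
  rewrite (cochainU s w).
  have -> : Defs.cover (Omega M) (s *: free_gen w) = s *: w.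
    by rewrite linearZ /=; congr (_ *: _); apply: malg_liftU.
  have -> : cover_env (Omega_val (s *: w)) = s * cover_env (Omega_val w).
    exact: (linearZ_LR cover_env).
  rewrite bar_pairing_equivariance // mult_cover_env.
  by case: w => w /= /eqP.
Qed.

Lemma cochain_scale k s g : cochain ((k *: s) *: g) = k *: cochain (s *: g).
Proof.
elim/malg_add_ind: g => [|g h IHg IHh|t w].
- by rewrite !scaler0 cochain0 scaler0.
- rewrite [X in X = _](congr1 cochain (scalerDr (k *: s) g h)).
  apply: etrans (cochainD _ _) _; apply: etrans (congr2 +%R IHg IHh) _.
  by rewrite -scalerDr -cochainD; congr (_ *: cochain _); apply/esym/scalerDr.
- rewrite (scale_free_gen (k *: s) t w) (scale_free_gen s t w).
  rewrite [X in X = _](cochainU ((k *: s) * t) w).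
  by rewrite [X in _ = _ *: X](cochainU (s * t) w) -scalerAl bar_pairingZl.
Qed.

(** On a syzygy the defects of [bar_pairing_equivariance] add up to a term
    computed from the image of that syzygy under the cover, which is 0. *)
Lemma cochain_linear (g : Omega (Omega M)) s :
  cochain (s *: Omega_val g) = env_act s (cochain (Omega_val g) : M).
Proof.
elim/env_ind: s => [|k s t IHs IHt|a b].
- by rewrite scale0r cochain0 (linear_fun0 (env_act_linear _)).
- apply: etrans (congr1 cochain (scalerDl (Omega_val g) (k *: s) t)) _.
  apply: etrans (cochainD _ _) _.
  apply: etrans (congr2 +%R (cochain_scale k s _) IHt) _.
  apply: etrans (congr1 (fun z => k *: z + _) IHs) _.
  exact/esym/env_act_linear.
- rewrite cochain_tensor; case: g => g /= /eqP ->.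
  rewrite -[Omega_val 0]/(0 : free_cover M) (linear0 cover_env).
  rewrite (linear_fun0 (contractionP a b)) subr0.
  by rewrite -[RHS]/(tensor a b *: (_ : M)) env_scaleE.
Qed.

Definition cochain_syzygy (g : Omega (Omega M)) : M := cochain (Omega_val g).

Lemma cochain_syzygyP : linear cochain_syzygy.
Proof.
move=> s g h; rewrite /cochain_syzygy.
have -> : Omega_val (s *: g + h) = s *: Omega_val g + Omega_val h by [].
by rewrite cochainD cochain_linear.
Qed.

Lemma cochain_syzygy0 : cochain_syzygy 0 = 0.
Proof.
by have := cochain_syzygyP (-1) 0 0; rewrite !scaleN1r oppr0 addr0 addNr.
Qed.

Definition ext_cocycle : res M 2 -> M := malg_lift cochain_syzygy.

Lemma ext_cocycleE (u : res M 2) :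
  ext_cocycle u = cochain_syzygy (Defs.cover (Omega (Omega M)) u).
Proof.
elim/(@malg_ind S (Omega (Omega M))): u => [|s u v IHu IHv|g].
- by rewrite /ext_cocycle !linear0 cochain_syzygy0.
- by rewrite linearP cochain_syzygyP -IHu -IHv; apply: malg_lift_is_linear.
- rewrite /ext_cocycle malg_liftU; congr cochain_syzygy.
  by apply/esym; apply: malg_liftU.
Qed.

Lemma ext_cocycleP : ext_cocycle \in @cocycle S M M 2.
Proof.
apply/asboolP; split=> [|x]; first exact: malg_lift_is_linear.
apply: etrans (ext_cocycleE _) _.
apply: etrans (congr1 cochain_syzygy _) cochain_syzygy0.
by apply/cover_kernelP; exists (Defs.cover (Omega (Omega (Omega M))) x).
Qed.

Hypothesis c_nontriv : ~ exists2 k : A -> A, linear k &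
  forall x y, c x y = x * k y - k (x * y) + k x * y.

(** The lifting of y (x) 1 - 1 (x) y to the standard resolution. These elements
    give the comparison map in the opposite direction, from the bar resolution. *)
Definition diff_gen (y : A) : free_cover M :=
  (tensor y 1 - tensor 1 y) *: free_gen (1 : M).

Lemma diff_genP y : diff_gen y \in @cover_kernel S M.
Proof.
apply/eqP; rewrite linearZ.
rewrite (cover_free_gen (1 : M)).
rewrite /= scalerBl !env_scaleE. by rewrite !mulr1 mul1r subrr.
Qed.

Definition diff_omega y : Omega M := OmegaElt (diff_genP y).

Lemma cover_env_diff y : cover_env (diff_gen y) = tensor y 1 - tensor 1 y.
Proof.
rewrite /diff_gen linearZ /=.
by rewrite cover_env_free_gen tensor11; apply: mulr1.
Qed.

Lemma cochain_diff s y : cochain (s *: free_gen (diff_omega y)) =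
  bar_pairing s (tensor y 1) - bar_pairing s (tensor 1 y).
Proof.
rewrite cochainU cover_env_diff.
by rewrite addrC -[- _]scaleN1r bar_pairingPr scaleN1r addrC.
Qed.

Lemma diff_gen_scale s y : s *: diff_gen y =
  (s * (tensor y 1 - tensor 1 y)) *: free_gen (1 : M) :> free_cover M.
Proof. by rewrite scalerA. Qed.

(** A linear extension [g] of the cocycle from the syzygies to the whole free
    module is evaluated on the syzygy x [w_y] - [w_xy] + [w_x] y, where
    w_y = y (x) 1 - 1 (x) y; this writes [c] as a coboundary. *)
Lemma cochain_coboundary (g : res M 1 -> M) : linear g ->
  (forall u, ext_cocycle u = g (res_d M 1 u)) ->
  exists2 k : A -> A, linear k &
    forall x y, c x y = x * k y - k (x * y) + k x * y.
Proof.
move=> lg gE.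
have gval (u : free_cover (Omega M)) : Defs.cover (Omega M) u = 0 -> g u = cochain u.
  move/cover_kernelP => [w <-].
  have := gE (free_gen w); rewrite ext_cocycleE.
  have -> : Defs.cover (Omega (Omega M)) (free_gen w) = w by apply: malg_liftU.
  have -> : res_d M 1 (free_gen w) = Omega_val w.
    by rewrite /res_d /=; congr Omega_val; apply: malg_liftU.
  by move=> <-.
have cover_diff s y : Omega_val (Defs.cover (Omega M) (s *: free_gen (diff_omega y))) =
    (s * (tensor y 1 - tensor 1 y)) *: free_gen (1 : M).
  rewrite linearZ /= -diff_gen_scale; congr (_ *: _).
  by rewrite cover_free_gen.
have g0 : g 0 = 0 by have := lg (-1) 0 0; rewrite !scaleN1r oppr0 addr0 addNr.
have gD u v : g (u + v) = g u + g v by have := lg 1 u v; rewrite !scale1r.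
have gZ s u : g (s *: u) = s *: g u by have := lg s u 0; rewrite g0 !addr0.
pose k0 (y : A) : A := g (free_gen (diff_omega y)).
have coverD (u v : free_cover (Omega M)) : Omega_val (Defs.cover (Omega M) (u + v)) =
    Omega_val (Defs.cover (Omega M) u) + Omega_val (Defs.cover (Omega M) v).
  by rewrite linearD.
pose d (y : A) : S := tensor y 1 - tensor 1 y.
have key (s1 s2 s3 : S) y1 y2 y3 : s1 * d y1 + (s2 * d y2 + s3 * d y3) = 0 ->
    (env_act s1 (k0 y1) : A) + ((env_act s2 (k0 y2) : A) + (env_act s3 (k0 y3) : A)) =
    (bar_pairing s1 (tensor y1 1) - bar_pairing s1 (tensor 1 y1)) +
    ((bar_pairing s2 (tensor y2 1) - bar_pairing s2 (tensor 1 y2)) +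
     (bar_pairing s3 (tensor y3 1) - bar_pairing s3 (tensor 1 y3))) :> A.
  move=> e; pose v1 := s1 *: free_gen (diff_omega y1).
  pose v2 := s2 *: free_gen (diff_omega y2); pose v3 := s3 *: free_gen (diff_omega y3).
  have u0 : Defs.cover (Omega M) (v1 + (v2 + v3)) = 0.
    apply: val_inj; apply: etrans (coverD _ _) _.
    apply: etrans (congr2 +%R (cover_diff s1 y1) (coverD v2 v3)) _.
    apply: etrans (congr1 (fun z => _ + z)
      (congr2 +%R (cover_diff s2 y2) (cover_diff s3 y3))) _.
    apply: etrans (congr1 (fun z => _ + z)
      (esym (scalerDl (free_gen (1 : M)) (s2 * d y2) (s3 * d y3)))) _.
    apply: etrans (esym (scalerDl (free_gen (1 : M)) (s1 * d y1) _)) _.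
    apply: etrans (congr1 (fun z => z *: free_gen (1 : M)) e) _.
    exact: scale0r.
  have := gval _ u0.
  have -> : g (v1 + (v2 + v3)) = s1 *: (k0 y1 : M) + (s2 *: (k0 y2 : M) + s3 *: (k0 y3 : M)).
    apply: etrans (gD _ _) _; apply: (congr2 +%R (gZ _ _)).
    by apply: etrans (gD _ _) _; apply: (congr2 +%R (gZ _ _) (gZ _ _)).
  move=> ->; apply: etrans (cochainD _ _) _.
  by apply: (congr2 +%R (cochain_diff _ _)); apply: etrans (cochainD _ _) _;
    apply: (congr2 +%R (cochain_diff _ _) (cochain_diff _ _)).
clearbody k0.
have [cl cr] := c_bilin.
have tensorZl m a b : tensor (m *: a) b = m *: tensor a b :> S.
  have := tensorPl b m a 0; rewrite /= addr0 => ->.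
  by rewrite (linear_fun0 (tensorPl b)) addr0.
have act_wordE a b (z : A) : env_act (tensor a b) z = a * z * b :> A by apply: env_scaleE.
have c1r a : c a 1 = a * c 1 1.
  have /eqP := c_cocycle a 1 1.
  by rewrite !mulr1 addrK subr_eq0 => /eqP.
have c1l a : c 1 a = c 1 1 * a.
  have /eqP := c_cocycle 1 1 a.
  by rewrite !mul1r addrNK subr_eq0 => /eqP.
set cc := c 1 1 in c1r c1l.
have bE a b y : bar_pairing (tensor a b) (tensor y 1) - bar_pairing (tensor a b) (tensor 1 y) =
    (a * y * cc - c a y) * b.
  by rewrite (bar_pairing_tensor a b y 1) (bar_pairing_tensor a b 1 y) (c1r (a * y)) mulr1 mulrBl.
(* The cocycle is not assumed normalised: by the cocycle identity
   c a 1 = a * c 1 1 and c 1 a = c 1 1 * a. *)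
have {}key a1 a2 a3 b1 b2 b3 y1 y2 y3 :
    tensor a1 b1 * d y1 + (tensor a2 b2 * d y2 + tensor a3 b3 * d y3) = 0 ->
    a1 * k0 y1 * b1 + (a2 * k0 y2 * b2 + a3 * k0 y3 * b3) =
    (a1 * y1 * cc - c a1 y1) * b1 + ((a2 * y2 * cc - c a2 y2) * b2 +
      (a3 * y3 * cc - c a3 y3) * b3).
  by move/key; rewrite (act_wordE a1) (act_wordE a2) (act_wordE a3) (bE a1) (bE a2) (bE a3).
have cZ m y : c (m *: 1) y = m *: (cc * y).
  by have := cl y m 1 0; rewrite /= (linear_fun0 (cl y)) !addr0 c1l.
have k0_lin : linear k0.
  move=> l y y'.
  have prem : tensor 1 1 * d (l *: y + y') +
      (tensor (- l *: 1) 1 * d y + tensor (- 1 *: 1) 1 * d y') = 0.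
    rewrite !tensorZl tensor11 /d mul1r -!scalerAl !mul1r !scaleNr scale1r tensorPl tensorPr.
    rewrite -opprD scalerBr [X in _ - X]addrACA.
    by rewrite -[X in _ - (_ + X)]opprD subrr.
  have := key _ _ _ _ _ _ _ _ _ prem; clear key prem.
  rewrite (c1l (l *: y + y')) (cZ (- l)) (cZ (- 1)) !mulr1 !mul1r.
  rewrite !mulr_algl -!scalerAl -!scalerBr !scaleNr !scale1r.
  rewrite mulrDl mulrDr -scalerAl -scalerAr -!opprD scalerBr.
  rewrite [l *: (y * cc) - _ + _]addrACA -[X in _ = _ - (_ + X)]opprD subrr.
  by move/eqP; rewrite subr_eq0 => /eqP.
have k0_cob x y : c x y = x * cc * y - (x * k0 y - k0 (x * y) + k0 x * y).
  have prem : tensor x 1 * d y + (tensor (- 1 *: 1) 1 * d (x * y) + tensor 1 y * d x) = 0.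
    rewrite (tensorZl (- 1)) tensor11 /d -scalerAl mul1r scaleN1r !mulrBr !tensorM.
    by rewrite !mul1r !mulr1 opprB telescope3.
  have := key _ _ _ _ _ _ _ _ _ prem; clear key prem.
  rewrite (c1l x) (cZ (- 1)) !mulr1 !mul1r !mulr_algl -!scalerAl !scaleN1r.
  rewrite opprK mulrBl !mulrA addrA => e.
  have {}e : x * k0 y - k0 (x * y) + k0 x * y = x * cc * y - c x y.
    rewrite e; move: (x * y * cc) (c x y) (cc * x * y) (x * cc * y) => p r q z.
    by rewrite (addrC z) [_ + (- q + _)]addrA addrK addrACA subrr add0r addrC.
  by rewrite e subKr.
(* The term x * c 1 1 * y left by [k0_cob] is the coboundary of y |-> y * c 1 1. *)
exists (fun y => y * c 1 1 - k0 y).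
  move=> l y y'; rewrite k0_lin mulrDl -scalerAl scalerBr opprD.
  exact: addrACA.
move=> x y; rewrite {1}k0_cob mulrBr mulrBl !mulrA.
move: (x * cc * y) (x * y * cc) (x * k0 y) (k0 (x * y)) (k0 x * y) => p q r s t.
rewrite opprB [q - r + _]addrC [s - q + _]addrA subrK.
by rewrite opprD opprB addrCA.
Qed.

Lemma HH2_neq0_of_cocycle : exists x : HH 2 A, x != 0.
Proof.
pose z := ZExt ext_cocycleP.
exists (\pi_(Quotient.quot (@coboundary S M M 2)) z)%qT.
rewrite -[X in _ != X](raddf0 (\pi_(Quotient.quot (@coboundary S M M 2)))%qT).
apply/negP; rewrite -Quotient.idealrBE subr0 => /asboolP[g lg gE].
by apply: c_nontriv; apply: (cochain_coboundary lg gE).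
Qed.
End HH2.

(** * Bimodule maps on an ideal of relations *)

Section IdealMap.
Variables (K : fieldType) (P : algType K) (G : P -> Prop).
Hypothesis G1 : ~ ideal_gen G 1.
Local Notation A := (quot_alg G1).
Local Notation I := (ideal_gen G).
Local Notation pi := (quot_pi G1).

Lemma ideal_genD x y : I x -> I y -> I (x + y).
Proof.
move=> Ix Iy; rewrite -[y]opprK; apply: (idealB (ideal_gen_ideal G)) => //.
rewrite -[- y]add0r; apply: (idealB (ideal_gen_ideal G)) => //.
exact: (ideal0 (ideal_gen_ideal G)).
Qed.

Lemma ideal_genZ k x : I x -> I (k *: x).
Proof.
move=> Ix; rewrite -[x]mul1r scalerAl; exact: (idealMl (ideal_gen_ideal G)).
Qed.

Lemma ideal_genP k x y : I x -> I y -> I (k *: x + y).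
Proof. by move=> Ix Iy; apply: ideal_genD => //; apply: ideal_genZ. Qed.

Lemma quot_pi_mul x y : pi (x * y) = pi x * pi y.
Proof. exact: rmorphM. Qed.

Lemma quot_pi_lin k x y : pi (k *: x + y) = k *: pi x + pi y.
Proof. exact: linearP. Qed.

Lemma quot_pi0P x : pi x = 0 <-> I x.
Proof.
by rewrite -[in X in _ <-> X](subr0 x) -(quot_pi_eq G1) linear0.
Qed.

Variable D : P -> A.
Hypothesis DP : forall k x y, I x -> I y -> D (k *: x + y) = k *: D x + D y.
Hypothesis DMl : forall p x, I x -> D (p * x) = pi p * D x.
Hypothesis DMr : forall p x, I x -> D (x * p) = D x * pi p.
Hypothesis D_outer : ~ exists d : P -> A,
  [/\ linear d, forall x y, d (x * y) = d x * pi y + pi x * d y &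
      forall x, I x -> d x = D x].

(** With a linear section [sg] of P -> A, the cocycle is
    c a b = D (sg a * sg b - sg (a * b)). If c is the coboundary of k, then
    u |-> D (u - sg (pi u)) + k (pi u) is a derivation of P that extends [D]. *)
Lemma HH2_neq0_of_ideal_map : exists x : HH 2 A, x != 0.
Proof.
have [p [pI p0]] := subspace_projection (ideal0 (ideal_gen_ideal G)) ideal_genP.
have DB x y : I x -> I y -> D (x - y) = D x - D y.
  by move=> Ix Iy; rewrite addrC -scaleN1r DP // scaleN1r addrC.
have DD x y : I x -> I y -> D (x + y) = D x + D y.
  by move=> Ix Iy; rewrite -[x]scale1r DP // !scale1r.
have D0 : D 0 = 0.
  by rewrite -(subrr 0) DB ?subrr //; apply: (ideal0 (ideal_gen_ideal G)).
pose sg (a : A) : P := p (repr a).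
have sgE x : sg (pi x) = p x.
  apply/eqP; rewrite -subr_eq0 -linearB; apply/eqP/p0/(quot_pi_eq G1).
  by rewrite /quot_pi reprK.
have pisg a : pi (sg a) = a.
  have [x <-] := quot_pi_surj a; rewrite sgE; apply/(quot_pi_eq G1).
  by rewrite -opprB -scaleN1r; apply: ideal_genZ.
have sg_lin : linear sg.
  move=> k a b; have [x <-] := quot_pi_surj a; have [y <-] := quot_pi_surj b.
  by rewrite -quot_pi_lin !sgE linearP.
pose E u := D (u - p u).
have E_lin : linear E.
  by move=> k u v; rewrite /E -DP //; congr D; rewrite linearP opprD addrACA -scalerBr.
have pE x : p x = sg (pi x) by rewrite sgE.
pose c (a b : A) : A := E (sg a * sg b).
have cE a b : c a b = D (sg a * sg b - sg (a * b)).
  by rewrite /c /E (pE (sg a * sg b)) quot_pi_mul (pisg a) (pisg b).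
have Ic a b : I (sg a * sg b - sg (a * b)).
  by apply/(quot_pi_eq G1); rewrite quot_pi_mul !pisg.
have c_bilin : bilinear_map c.
  split=> [b k x y|a k x y]; rewrite /c sg_lin.
    by rewrite mulrDl -scalerAl E_lin.
  by rewrite mulrDr -scalerAr E_lin.
apply: (@HH2_neq0_of_cocycle K A c c_bilin) => [x y z|[k k_lin kE]].
- have -> : x * c y z = D (sg x * (sg y * sg z - sg (y * z))).
    by rewrite DMl // pisg cE.
  have -> : c x y * z = D ((sg x * sg y - sg (x * y)) * sg z).
    by rewrite DMr // pisg cE.
  have I1 : I (sg x * (sg y * sg z - sg (y * z))).
    exact: (idealMl (ideal_gen_ideal G)).
  have I2 : I ((sg x * sg y - sg (x * y)) * sg z).
    exact: (Defs.idealMr (ideal_gen_ideal G)).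
  rewrite !cE -DB // -DD //; last exact: (idealB (ideal_gen_ideal G)).
  rewrite -DB //; last first.
    by apply: ideal_genD => //; apply: (idealB (ideal_gen_ideal G)).
  by rewrite mulrBr mulrBl !mulrA alternating4 D0.
- apply: D_outer; exists (fun u => E u + k (pi u)); split.
  + move=> l u v; rewrite E_lin quot_pi_lin k_lin scalerDr; exact: addrACA.
  + move=> u v.
    have Iu : I ((u - p u) * v) by apply: (Defs.idealMr (ideal_gen_ideal G)).
    have Iv : I (p u * (v - p v)) by apply: (idealMl (ideal_gen_ideal G)).
    (* u v - p (u v) is decomposed as (u - p u) v + p u (v - p v) + (p u p v - p (u v)). *)
    have -> : E (u * v) = E u * pi v + pi u * E v + c (pi u) (pi v).
      have -> : pi u * E v = D (p u * (v - p v)) by rewrite DMl // pE pisg.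
      rewrite -DMr // cE -quot_pi_mul -!pE -DD // -DD //; last first.
      * by have := Ic (pi u) (pi v); rewrite -quot_pi_mul -!pE.
      * exact: ideal_genD.
      by rewrite mulrBl mulrBr !addrA !subrK.
    rewrite kE quot_pi_mul mulrDl mulrDr [_ - _ + _]addrAC [X in X + _]addrA subrK.
    by rewrite [X in _ + X]addrC addrACA.
  + move=> x Ix; rewrite /E p0 // subr0; have /quot_pi0P -> := Ix.
    by rewrite (linear_fun0 k_lin) addr0.
Qed.
End IdealMap.

(** * Path algebras *)

Section PathAlgebra.
Variables (K : fieldType) (Q : quiver).
Local Notation P := (path_alg K Q).

(** Defined on all words, with value 0 on those that are not walks, so that
    products need no side conditions. *)
Definition path_elt (v : vertex Q) (s : seq (arrow Q)) : P :=
  oapp (@pbasis K (path_monoid Q)) 0 (insub (v, s)).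

Definition path_idem (v : vertex Q) : P := path_elt v [::].
Definition path_arr (a : arrow Q) : P := path_elt (src a) [:: a].
Local Notation idem := path_idem.
Local Notation arr := path_arr.

Lemma pbasisE (q : path_monoid Q) : pbasis q = path_elt (val q).1 (val q).2.
Proof. by rewrite /path_elt -surjective_pairing valK. Qed.

Lemma path_elt_walkN v s : ~~ walk v s -> path_elt v s = 0.
Proof. by move=> ns; rewrite /path_elt insubN. Qed.

Lemma path_eltE v s (ws : walk v s) :
  path_elt v s = @pbasis K (path_monoid Q) (QPath (path_val := (v, s)) ws).
Proof. by rewrite /path_elt insubT. Qed.

Lemma path_eltM v s w t : path_elt v s * path_elt w t =
  if walk v s && (last v (map tgt s) == w) then path_elt v (s ++ t) else 0.
Proof.
have [ws|/path_elt_walkN->] := boolP (walk v s); last by rewrite mul0r.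
have [wt|nt] := boolP (walk w t); last first.
  rewrite (path_elt_walkN nt) mulr0 /=; case: eqP => // e.
  by rewrite path_elt_walkN // walk_cat e (negPf nt) andbF.
rewrite (path_eltE ws) (path_eltE wt) pbasisM /pmulU /=.
have [e|n] := eqVneq; last by rewrite path_concatN.
have [r -> hr] := @path_concatP _ (QPath (path_val := (v, s)) ws)
  (QPath (path_val := (w, t)) wt) e.
by rewrite /= pbasisE hr.
Qed.

Lemma path_elt_ind (R : P -> Prop) : R 0 ->
  (forall k g h, R g -> R h -> R (k *: g + h)) ->
  (forall v s, R (path_elt v s)) -> forall x, R x.
Proof.
by move=> R0 RP Rp x; elim/palg_ind: x => // q; rewrite pbasisE.
Qed.

Lemma path_elt_rcons v s a : path_elt v (rcons s a) = path_elt v s * arr a.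
Proof.
rewrite /path_arr path_eltM cats1; case: ifPn => // h; apply: path_elt_walkN.
by rewrite -cats1 walk_cat /= andbT eq_sym.
Qed.

Lemma path_elt_cons v a s :
  path_elt v (a :: s) = if src a == v then arr a * path_elt (tgt a) s else 0.
Proof.
rewrite /path_arr path_eltM /= !eqxx /=; case: eqP => [->//|n].
by apply: path_elt_walkN => /=; case: eqP.
Qed.

Lemma path_indr (R : P -> Prop) : R 0 ->
  (forall k g h, R g -> R h -> R (k *: g + h)) ->
  (forall v, R (idem v)) -> (forall x a, R x -> R (x * arr a)) -> forall x, R x.
Proof.
move=> R0 RP Re Ra; apply: path_elt_ind => // v; elim/last_ind => [|s a Rs]; first exact: Re.
by rewrite path_elt_rcons; apply: Ra.
Qed.

Lemma path_indl (R : P -> Prop) : R 0 ->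
  (forall k g h, R g -> R h -> R (k *: g + h)) ->
  (forall v, R (idem v)) -> (forall x a, R x -> R (arr a * x)) -> forall x, R x.
Proof.
move=> R0 RP Re Ra; apply: path_elt_ind => // v s; elim: s v => [v|a s Rs v]; first exact: Re.
by rewrite path_elt_cons; case: ifP => // _; apply: Ra.
Qed.

Lemma idemM v w : idem v * idem w = if v == w then idem v else 0.
Proof. by rewrite /path_idem path_eltM /=; case: eqP. Qed.

Lemma idem_arr v a : idem v * arr a = if v == src a then arr a else 0.
Proof. by rewrite /path_idem /path_arr path_eltM /=; case: eqP => // ->. Qed.

Lemma arr_idem v a : arr a * idem v = if v == tgt a then arr a else 0.
Proof. by rewrite /path_idem /path_arr path_eltM /= eqxx /= eq_sym; case: eqP. Qed.

Lemma sum_idem : \sum_v idem v = 1.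
Proof.
rewrite -[1]/(palg_one _ _) /palg_one /= big_map big_enum /=.
by apply: eq_bigr => v _; rewrite pbasisE.
Qed.

Section Lift.
Variables (V : lmodType K) (f : vertex Q -> seq (arrow Q) -> V).
Hypothesis f_walkN : forall v s, ~~ walk v s -> f v s = 0.

Definition path_lift (x : P) : V :=
  malg_lift (fun q : path_monoid Q => f (val q).1 (val q).2) x.

Lemma path_liftP : linear path_lift.
Proof. exact: malg_lift_is_linear. Qed.

HB.instance Definition _ := GRing.isLinear.Build K P V *:%R path_lift path_liftP.

Lemma path_liftE v s : path_lift (path_elt v s) = f v s.
Proof.
have [ws|ns] := boolP (walk v s); last first.
  by rewrite (path_elt_walkN ns) (linear_fun0 path_liftP) f_walkN.
rewrite path_eltE /path_lift pbasis.unlock; exact: malg_liftU.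
Qed.
End Lift.

End PathAlgebra.

HB.lock Definition homog_part (K : fieldType) (Q : quiver) (n : nat) (x : path_alg K Q) :
  path_alg K Q := path_lift (fun v s => if size s == n then path_elt K v s else 0) x.

(** Every x of positive degree is the sum over the arrows a of
    (right_deriv a x) * a, in a unique way if the coefficient of a ends at the
    source of a: these are the coefficients. *)
HB.lock Definition right_deriv (K : fieldType) (Q : quiver) (a : arrow Q) (x : path_alg K Q) :
  path_alg K Q := path_lift (fun v s => if rev s is b :: t then
     (if (b == a) && walk v s then path_elt K v (rev t) else 0) else 0) x.

Section PathOperators.
Variables (K : fieldType) (Q : quiver).
Local Notation P := (path_alg K Q).
Local Notation path_elt := (@path_elt K Q).
Local Notation idem := (@path_idem K Q).
Local Notation arr := (@path_arr K Q).

Lemma homog_partP n : linear (@homog_part K Q n).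
Proof. by rewrite homog_part.unlock; apply: path_liftP. Qed.

HB.instance Definition _ n := GRing.isLinear.Build K P P *:%R (@homog_part K Q n) (homog_partP n).

Lemma homog_part_path n v s : homog_part n (path_elt v s) = if size s == n then path_elt v s else 0.
Proof.
by rewrite homog_part.unlock; apply: path_liftE => v' s' /path_elt_walkN ->; case: ifP.
Qed.

Lemma homog_part_idem n v : homog_part n (idem v) = if n == 0%N then idem v else 0.
Proof. by rewrite homog_part_path eq_sym. Qed.

Lemma homog_part_arr_r n x a : homog_part n (x * arr a) = if n is m.+1 then homog_part m x * arr a else 0.
Proof.
elim/path_elt_ind: x => [|k g h IHg IHh|v s].
- by case: n => [|n]; rewrite mul0r !linear0 ?mul0r.
- rewrite mulrDl -scalerAl homog_partP IHg IHh.
  by case: n {IHg IHh} => [|n]; rewrite ?scaler0 ?addr0 // homog_partP mulrDl -scalerAl.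
- rewrite -path_elt_rcons homog_part_path size_rcons path_elt_rcons.
  by case: n => //= n; rewrite eqSS homog_part_path; case: ifP; rewrite ?mul0r.
Qed.

Lemma homog_part_arr_l n x a : homog_part n (arr a * x) = if n is m.+1 then arr a * homog_part m x else 0.
Proof.
elim/path_elt_ind: x => [|k g h IHg IHh|v s].
- by case: n => [|n]; rewrite mulr0 !linear0 ?mulr0.
- rewrite mulrDr -scalerAr homog_partP IHg IHh.
  by case: n {IHg IHh} => [|n]; rewrite ?scaler0 ?addr0 // homog_partP mulrDr -scalerAr.
- have [e|ne] := eqVneq (tgt a) v; last first.
    have z : arr a * path_elt v s = 0 by rewrite /path_arr path_eltM /= (negPf ne) andbF.
    rewrite z linear0; case: n => // n.
    by rewrite homog_part_path; case: ifP; rewrite ?mulr0 // z.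
  have -> : arr a * path_elt v s = path_elt (src a) (a :: s).
    by rewrite path_elt_cons eqxx e.
  rewrite homog_part_path /=; case: n => // n; rewrite eqSS homog_part_path path_elt_cons eqxx e.
  by case: ifP; rewrite ?mulr0.
Qed.

Lemma homog_part_idem_r n x v : homog_part n (x * idem v) = homog_part n x * idem v.
Proof.
elim/path_elt_ind: x => [|k g h IHg IHh|w s].
- by rewrite mul0r linear0 mul0r.
- by rewrite mulrDl -scalerAl !homog_partP IHg IHh mulrDl -scalerAl.
- rewrite homog_part_path (fun_if (fun z => z * idem v)) mul0r /path_idem path_eltM cats0.
  by case: ifP => _; rewrite ?homog_part_path ?linear0 //; case: ifP.
Qed.

Lemma homog_part_idem_l n x v : homog_part n (idem v * x) = idem v * homog_part n x.
Proof.
elim/path_elt_ind: x => [|k g h IHg IHh|w s].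
- by rewrite mulr0 linear0 mulr0.
- by rewrite mulrDr -scalerAr !homog_partP IHg IHh mulrDr -scalerAr.
- rewrite homog_part_path (fun_if (fun z => idem v * z)) mulr0 /path_idem path_eltM /=.
  case: eqP => [->|_]; first by rewrite homog_part_path.
  by rewrite linear0 if_same.
Qed.

Lemma homog_part_homog m n (x : P) : homog_part m (homog_part n x) = if m == n then homog_part n x else 0.
Proof.
elim/path_elt_ind: x => [|k g h IHg IHh|w s].
- by rewrite !linear0 if_same.
- rewrite !homog_partP IHg IHh.
  by case: ifP => // _; rewrite scaler0 addr0.
- rewrite homog_part_path; case: (eqVneq (size s) n) => [<-|_].
    by rewrite homog_part_path eq_sym.
  by rewrite linear0 if_same.
Qed.

Lemma homog_part_finite (x : P) : exists N, x = \sum_(n < N) homog_part n x /\ forall n, (N <= n)%N -> homog_part n x = 0.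
Proof.
elim/path_elt_ind: x => [|k g h [N [gE gN]] [M [hE hM]]|v s].
- by exists 0%N; rewrite big_ord0; split=> // n _; rewrite linear0.
- have widen L (z : P) D : z = \sum_(n < L) homog_part n z ->
      (forall n, (L <= n)%N -> homog_part n z = 0) -> (L <= D)%N -> z = \sum_(n < D) homog_part n z.
    move=> zE zL LD; rewrite {1}zE -!(big_mkord xpredT (fun n => homog_part n z)).
    rewrite [RHS](@big_cat_nat _ _ _ L) //= [X in _ + X]big_nat_cond [X in _ + X]big1 ?addr0 //.
    by move=> n /andP[/andP[Ln _] _]; apply: zL.
  exists (maxn N M); split=> [|n].
    under eq_bigr do rewrite homog_partP.
    rewrite big_split /= -scaler_sumr.
    by rewrite -(widen _ _ _ gE gN) ?leq_maxl // -(widen _ _ _ hE hM) ?leq_maxr.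
  by rewrite geq_max => /andP[/gN gn /hM hn]; rewrite homog_partP gn hn scaler0 addr0.
- exists (size s).+1; split=> [|n sn]; last by rewrite homog_part_path; case: eqP sn => // ->; rewrite ltnn.
  rewrite (bigD1 ord_max) //= homog_part_path eqxx big1 ?addr0 // => n.
  by rewrite -val_eqE /= homog_part_path eq_sym => /negPf->.
Qed.

Lemma right_derivP a : linear (@right_deriv K Q a).
Proof. by rewrite right_deriv.unlock; apply: path_liftP. Qed.

HB.instance Definition _ a := GRing.isLinear.Build K P P *:%R (@right_deriv K Q a) (right_derivP a).

Lemma right_deriv_path a v s : right_deriv a (path_elt v s) = if rev s is b :: t then
     (if (b == a) && walk v s then path_elt v (rev t) else 0) else 0.
Proof.
rewrite right_deriv.unlock; apply: path_liftE => v' s' ns; case: (rev s') => // b t.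
by rewrite (negPf ns) andbF.
Qed.

Lemma right_deriv_idem a v : right_deriv a (idem v) = 0.
Proof. by rewrite right_deriv_path. Qed.

Lemma right_deriv_arr a b x : right_deriv a (x * arr b) = if b == a then x * idem (src a) else 0.
Proof.
elim/path_elt_ind: x => [|k g h IHg IHh|w s].
- by rewrite !mul0r linear0 if_same.
- rewrite mulrDl -scalerAl right_derivP IHg IHh.
  by case: ifP => _; rewrite ?scaler0 ?addr0 // mulrDl -scalerAl.
- rewrite -path_elt_rcons right_deriv_path rev_rcons revK -cats1 walk_cat /= andbT.
  by case: (eqVneq b a) => //= ->; rewrite /path_idem path_eltM cats0 eq_sym.
Qed.

Lemma right_deriv_sum x a : x * arr a = \sum_b right_deriv b (x * arr a) * arr b.
Proof.
rewrite (bigD1 a) //= right_deriv_arr eqxx -mulrA idem_arr eqxx.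
rewrite big1 ?addr0 // => b /negPf nb.
by rewrite right_deriv_arr eq_sym nb mul0r.
Qed.

Lemma right_deriv_idem_r a x v : right_deriv a (x * idem v) = if v == tgt a then right_deriv a x else 0.
Proof.
elim/path_indr: x => [|k g h IHg IHh|u|x b _].
- by rewrite mul0r linear0 if_same.
- rewrite mulrDl -scalerAl !right_derivP IHg IHh.
  by case: ifP => // _; rewrite scaler0 addr0.
- by rewrite idemM right_deriv_idem if_same; case: ifP; rewrite ?right_deriv_idem ?linear0.
- rewrite -mulrA arr_idem right_deriv_arr; case: (eqVneq b a) => [->|nb].
    by case: ifP; rewrite ?mulr0 ?linear0 // right_deriv_arr eqxx.
  by case: ifP; rewrite ?mulr0 ?linear0 ?right_deriv_arr ?(negPf nb) if_same.
Qed.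

Lemma right_deriv_src a (x : P) : right_deriv a x * idem (src a) = right_deriv a x.
Proof.
elim/path_indr: x => [|k g h IHg IHh|u|x b _].
- by rewrite linear0 mul0r.
- by rewrite right_derivP mulrDl -scalerAl IHg IHh.
- by rewrite right_deriv_idem mul0r.
- by rewrite right_deriv_arr; case: ifP; rewrite ?mul0r // -mulrA idemM eqxx.
Qed.

Lemma right_deriv_idem_l a x w : right_deriv a (idem w * x) = idem w * right_deriv a x.
Proof.
elim/path_indr: x => [|k g h IHg IHh|u|x b _].
- by rewrite mulr0 linear0 mulr0.
- by rewrite mulrDr -scalerAr !right_derivP IHg IHh mulrDr -scalerAr.
- by rewrite idemM right_deriv_idem mulr0; case: ifP; rewrite ?right_deriv_idem ?linear0.
- by rewrite mulrA !right_deriv_arr; case: ifP; rewrite ?mulr0 // mulrA.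
Qed.

Lemma homog_part_deriv n a (x : P) : homog_part n (right_deriv a x) = right_deriv a (homog_part n.+1 x).
Proof.
elim/path_indr: x => [|k g h IHg IHh|u|x b _].
- by rewrite !linear0.
- by rewrite right_derivP !homog_partP right_derivP IHg IHh.
- by rewrite right_deriv_idem homog_part_idem !linear0.
- rewrite homog_part_arr_r !right_deriv_arr; case: ifP => _; last exact: linear0.
  exact: homog_part_idem_r.
Qed.

Lemma right_deriv_homog0 a (x : P) : right_deriv a (homog_part 0 x) = 0.
Proof.
elim/path_indr: x => [|k g h IHg IHh|u|x b _].
- by rewrite !linear0.
- by rewrite homog_partP right_derivP IHg IHh scaler0 addr0.
- by rewrite homog_part_idem /= right_deriv_idem.
- by rewrite homog_part_arr_r linear0.
Qed.

Lemma homog_part_deriv_sum n (x : P) : homog_part n.+1 x = \sum_a right_deriv a (homog_part n.+1 x) * arr a.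
Proof.
elim/path_indr: x => [|k g h IHg IHh|u|x b _].
- by rewrite !linear0 big1 // => a _; rewrite linear0 mul0r.
- rewrite homog_partP {1}IHg {1}IHh scaler_sumr -big_split; apply: eq_bigr => a _ /=.
  by rewrite right_derivP mulrDl -scalerAl.
- by rewrite homog_part_idem big1 // => a _; rewrite linear0 mul0r.
- by rewrite homog_part_arr_r -right_deriv_sum.
Qed.
End PathOperators.

(** * The preprojective ideal *)

Section Star.
Variable Q : quiver.
Definition star (a : arrow (double_quiver Q)) : arrow (double_quiver Q) :=
  match a with inl b => inr b | inr b => inl b end.

Lemma starK : involutive star. Proof. by case. Qed.
Lemma src_star a : src (star a) = tgt a. Proof. by case: a. Qed.
Lemma tgt_star a : tgt (star a) = src a. Proof. by case: a. Qed.

Variable K : fieldType.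
Definition sgn (a : arrow (double_quiver Q)) : K :=
  if a is inl _ then 1 else -1.

Lemma sgn_star a : sgn (star a) = - sgn a.
Proof. by case: a => a //=; rewrite opprK. Qed.

Lemma sgnK a : sgn a * sgn a = 1.
Proof. by case: a => a /=; rewrite ?mulr1 // mulrNN mulr1. Qed.
End Star.

Section Preprojective.
Variables (K : fieldType) (Q : quiver).
Local Notation DQ := (double_quiver Q).
Local Notation P := (path_alg K DQ).
Local Notation I := (ideal_gen (@preproj_rel K Q)).
Local Notation idem := (@path_idem K DQ).
Local Notation arr := (@path_arr K DQ).
Local Notation homog_part := (@homog_part K DQ).
Local Notation right_deriv := (@right_deriv K DQ).
Local Notation sgn := (@sgn Q K).
Local Notation rho := (@preproj_elt K Q).

Lemma rhoE : rho = \sum_b sgn b *: (arr b * arr (star b)).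
Proof.
have arrE a : alg_arrow K a = arr a.
  rewrite /alg_arrow pbasisE /=; congr path_elt.
rewrite big_sumType /= -big_split; apply: eq_bigr => a _ /=.
by rewrite !arrE scale1r scaleN1r.
Qed.

Lemma preproj_ideal0 : I 0. Proof. exact: (ideal0 (ideal_gen_ideal _)). Qed.
Lemma preproj_idealD x y : I x -> I y -> I (x + y). Proof. exact: ideal_genD. Qed.
Lemma preproj_idealB x y : I x -> I y -> I (x - y).
Proof. exact: (idealB (ideal_gen_ideal _)). Qed.
Lemma preproj_idealZ k x : I x -> I (k *: x). Proof. exact: ideal_genZ. Qed.
Lemma preproj_idealMl a x : I x -> I (a * x). Proof. exact: (idealMl (ideal_gen_ideal _)). Qed.
Lemma preproj_idealMr a x : I x -> I (x * a). Proof. exact: (Defs.idealMr (ideal_gen_ideal _)). Qed.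
Lemma preproj_elt_ideal : I rho. Proof. exact: ideal_gen_sub. Qed.
Lemma preproj_ideal_sum (J : finType) (F : J -> P) : (forall i, I (F i)) -> I (\sum_i F i).
Proof. by move=> IF; elim/big_ind: _ => //; [exact: preproj_ideal0 | exact: preproj_idealD]. Qed.

(** The ideal is obtained from the relation by linear combinations and by
    multiplications by arrows and idempotents, since these generate the algebra. *)
Lemma preproj_ideal_ind (R : P -> Prop) : R 0 ->
  (forall k x y, R x -> R y -> R (k *: x + y)) ->
  (forall a x, R x -> R (arr a * x)) -> (forall v x, R x -> R (idem v * x)) ->
  (forall a x, R x -> R (x * arr a)) -> (forall v x, R x -> R (x * idem v)) ->
  R rho -> forall x, I x -> R x.
Proof.
move=> R0 RP Ral Rel Rar Rer Rrho x Ix; apply: (Ix R) => [|_ ->] //.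
split=> // [u v Ru Rv|a u Ru|a u Ru].
- by rewrite addrC -scaleN1r; apply: RP.
- elim/path_indl: a u Ru => [|k g h IHg IHh|v|y a IHy] u Ru.
  + by rewrite mul0r.
  + by rewrite mulrDl -scalerAl; apply: RP; [apply: IHg | apply: IHh].
  + exact: Rel.
  + by rewrite -mulrA; apply/Ral/IHy.
- elim/path_indr: a u Ru => [|k g h IHg IHh|v|y a IHy] u Ru.
  + by rewrite mulr0.
  + by rewrite mulrDr -scalerAr; apply: RP; [apply: IHg | apply: IHh].
  + exact: Rer.
  + by rewrite mulrA; apply/Rar/IHy.
Qed.

Lemma idem_rho v : idem v * rho = rho * idem v.
Proof.
rewrite rhoE mulr_sumr mulr_suml; apply: eq_bigr => b _.
rewrite -scalerAl -scalerAr (mulrA (idem v)) idem_arr -(mulrA (arr b)) arr_idem tgt_star.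
by case: eqP; rewrite ?mul0r ?mulr0.
Qed.

Lemma homog_part_rho n : homog_part n rho = if n == 2 then rho else 0.
Proof.
have prA m a : homog_part m (arr a) = if m == 1%N then arr a else 0.
  by rewrite homog_part_path /= eq_sym.
rewrite rhoE linear_sum; case: ifP => [/eqP->|n2].
  by apply: eq_bigr => b _; rewrite linearZ /= homog_part_arr_r /= prA.
rewrite big1 // => b _; rewrite linearZ /= homog_part_arr_r.
by case: n n2 => [|[|[|n]]] // _; rewrite ?prA ?mul0r scaler0.
Qed.

Lemma preproj_ideal_homog n x : I x -> I (homog_part n x).
Proof.
move=> Ix; elim/preproj_ideal_ind: x / Ix n => [|k x y IHx IHy|a x IH|v x IH|a x IH|v x IH|] n.
- by rewrite linear0; apply: preproj_ideal0.
- by rewrite homog_partP; apply: preproj_idealD => //; apply: preproj_idealZ.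
- by rewrite homog_part_arr_l; case: n => [|n]; [exact: preproj_ideal0 | apply: preproj_idealMl].
- by rewrite homog_part_idem_l; apply: preproj_idealMl.
- by rewrite homog_part_arr_r; case: n => [|n]; [exact: preproj_ideal0 | apply: preproj_idealMr].
- by rewrite homog_part_idem_r; apply: preproj_idealMr.
- by rewrite homog_part_rho; case: ifP => _; [exact: preproj_elt_ideal | exact: preproj_ideal0].
Qed.

Lemma preproj_ideal_of_homog x : (forall n, I (homog_part n x)) -> I x.
Proof. by move=> Ix; have [N [-> _]] := homog_part_finite x; apply: preproj_ideal_sum => n. Qed.

Lemma right_deriv_rho a p : right_deriv a (p * rho) = - sgn a *: (p * arr (star a)).
Proof.
rewrite rhoE mulr_sumr linear_sum (bigD1 (star a)) //= big1 ?addr0 => [|b nb].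
  by rewrite -scalerAr linearZ /= mulrA right_deriv_arr starK eqxx sgn_star -mulrA arr_idem tgt_star eqxx.
rewrite -scalerAr linearZ /= mulrA right_deriv_arr; case: eqP => [e|]; last by rewrite scaler0.
by rewrite -e starK eqxx in nb.
Qed.

(** The ideal P rho P is sorted by last arrows: I = P rho + sum_a I a. The right
    hand side is stable under right multiplication because p rho b lies in I b. *)
Lemma ideal_decomp u : I u -> exists p U,
  (forall a, I (U a)) /\ u = p * rho + \sum_a U a * arr a.
Proof.
move=> Iu; elim/preproj_ideal_ind: u / Iu => [|k x y [p [U [IU ->]]] [q [V [IV ->]]]|
    b x [p [U [IU ->]]]|v x [p [U [IU ->]]]|b x [p [U [IU e]]]|v x [p [U [IU ->]]]|].
- exists 0, (fun => 0); split=> [a|]; first exact: preproj_ideal0.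
  by rewrite mul0r add0r big1 // => a _; rewrite mul0r.
- exists (k *: p + q), (fun a => k *: U a + V a); split=> [a|].
    by apply: preproj_idealD => //; apply: preproj_idealZ.
  rewrite mulrDl -scalerAl scalerDr addrACA; congr (_ + _).
  by rewrite scaler_sumr -big_split; apply: eq_bigr => a _; rewrite mulrDl -scalerAl.
- exists (arr b * p), (fun a => arr b * U a); split=> [a|]; first exact: preproj_idealMl.
  rewrite mulrDr mulrA; congr (_ + _); rewrite mulr_sumr.
  by apply: eq_bigr => a _; rewrite mulrA.
- exists (idem v * p), (fun a => idem v * U a); split=> [a|]; first exact: preproj_idealMl.
  rewrite mulrDr mulrA; congr (_ + _); rewrite mulr_sumr.
  by apply: eq_bigr => a _; rewrite mulrA.
- exists 0, (fun a => if a == b then x else 0); split=> [a|].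
    case: eqP => _; last exact: preproj_ideal0.
    rewrite e; apply: preproj_idealD; first by apply: preproj_idealMl; apply: preproj_elt_ideal.
    by apply: preproj_ideal_sum => c; apply: preproj_idealMr.
  rewrite mul0r add0r (bigD1 b) //= eqxx big1 ?addr0 // => a /negPf->.
  by rewrite mul0r.
- exists (p * idem v), (fun a => if v == tgt a then U a else 0); split=> [a|].
    by case: ifP => _ //; apply: preproj_ideal0.
  rewrite mulrDl -!mulrA idem_rho; congr (_ + _); rewrite mulr_suml; apply: eq_bigr => a _.
  by rewrite -mulrA arr_idem; case: ifP; rewrite ?mul0r ?mulr0.
- exists 1, (fun => 0); split=> [a|]; first exact: preproj_ideal0.
  by rewrite mul1r big1 ?addr0 // => a _; rewrite mul0r.
Qed.

(** Exactness at the middle term of the complex A -> sum_a A -> A, where the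
    first map is multiplication by the opposite arrows, with signs, and the
    second one sends a family y to sum_a y_a a. *)
Lemma ideal_exact (y : arrow DQ -> P) : I (\sum_a y a * arr a) ->
  exists p, forall a, I (y a * idem (src a) + sgn a *: (p * arr (star a))).
Proof.
move=> /ideal_decomp[p [U [IU e]]]; exists p => a.
have /(congr1 (right_deriv a)) := e; rewrite linearD /= right_deriv_rho !linear_sum /=.
have S (z : arrow DQ -> P) : \sum_b right_deriv a (z b * arr b) = z a * idem (src a).
  rewrite (bigD1 a) //= right_deriv_arr eqxx big1 ?addr0 // => b /negPf nb.
  by rewrite right_deriv_arr nb.
rewrite !S => ->; rewrite scaleNr addrAC addNr add0r; exact: preproj_idealMr.
Qed.

End Preprojective.

(** * Linear independence modulo a subspace *)

Section IndependenceModulo.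
Variables (K : fieldType) (L : lmodType K) (J : L -> Prop).
Hypothesis J0 : J 0.
Hypothesis JP : forall k x y, J x -> J y -> J (k *: x + y).

(** Dimensions of quotients are handled through families in the ambient space. *)
Definition indep_mod (T : finType) (x : T -> L) : Prop :=
  forall c : T -> K, J (\sum_t c t *: x t) -> forall t, c t = 0.

Definition span_mod (T : finType) (x : T -> L) (z : L) : Prop :=
  exists c : T -> K, J (z - \sum_t c t *: x t).

Let JD x y : J x -> J y -> J (x + y).
Proof. by move=> Jx Jy; rewrite -[x]scale1r; apply: JP. Qed.
Let JZ k x : J x -> J (k *: x).
Proof. by move=> Jx; rewrite -[_ *: _]addr0; apply: JP. Qed.
Let Jsum (T : finType) (F : T -> L) : (forall t, J (F t)) -> J (\sum_t F t).
Proof. by move=> JF; elim/big_ind: _. Qed.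

Lemma indep_card_le (T U : finType) (x : T -> L) (y : U -> L) :
  indep_mod x -> (forall t, span_mod y (x t)) -> (#|T| <= #|U|)%N.
Proof.
move=> ix sx; have [M ME] := choice sx.
pose A := \matrix_(i < #|T|, j < #|U|) M (enum_val i) (enum_val j).
rewrite leqNgt; apply/negP => lt.
have : kermx A != 0.
  by rewrite kermx_eq0 /row_free neq_ltn (leq_ltn_trans (rank_leq_col _) lt).
case/matrix0Pn => i [j nz]; case/eqP: nz.
pose c t := kermx A i (enum_rank t).
suff: forall t, c t = 0 by move/(_ (enum_val j)); rewrite /c enum_valK.
apply: ix.
have kA u : \sum_t c t * M t u = 0.
  have /matrixP/(_ i (enum_rank u)) := mulmx_ker A; rewrite mxE [RHS]mxE => e.
  rewrite -[RHS]e [RHS](reindex (fun t : T => enum_rank t)) /=; last first.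
    by exists enum_val => k _; rewrite ?enum_rankK ?enum_valK.
  by apply: eq_bigr => t _; rewrite /c [A _ _]mxE !enum_rankK.
have -> : \sum_t c t *: x t = \sum_t c t *: (x t - \sum_u M t u *: y u).
  under [RHS]eq_bigr do rewrite scalerBr.
  rewrite sumrB [X in _ - X](_ : _ = 0) ?subr0 //.
  under eq_bigr do rewrite scaler_sumr; rewrite exchange_big big1 // => u _.
  by under eq_bigr do rewrite scalerA; rewrite -scaler_suml kA scale0r.
by apply: Jsum => t; apply: JZ.
Qed.

Lemma span_mod_lin (T : finType) (x : T -> L) k y z :
  span_mod x y -> span_mod x z -> span_mod x (k *: y + z).
Proof.
move=> [c Jc] [d Jd]; exists (fun t => k * c t + d t).
under eq_bigr do rewrite scalerDl -scalerA.
rewrite big_split -scaler_sumr opprD addrACA -scalerBr /=; exact: JP.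
Qed.

Lemma span_mod0 (T : finType) (x : T -> L) z : J z -> span_mod x z.
Proof.
by move=> Jz; exists (fun => 0); rewrite big1 ?subr0 // => t _; rewrite scale0r.
Qed.

Lemma span_mod_gen (T : finType) (x : T -> L) t : span_mod x (x t).
Proof.
exists (fun u => (u == t)%:R); rewrite (bigD1 t) //= eqxx scale1r big1 ?addr0 ?subrr // => u /negPf->.
by rewrite scale0r.
Qed.

Lemma indep_mod_notin (T : finType) (x : T -> L) t : indep_mod x -> ~ J (x t).
Proof.
move=> ix Jx; have /ix/(_ t)/eqP : J (\sum_u (u == t)%:R *: x u).
  by rewrite (bigD1 t) //= eqxx scale1r big1 ?addr0 // => u /negPf->; rewrite scale0r.
by rewrite eqxx oner_eq0.
Qed.

(** Every finite family contains a basis of its span modulo [J]: drop the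
    elements that are combinations of the later ones. *)
Lemma basis_mod (s : seq L) : exists t : seq L,
  [/\ {subset t <= s}, indep_mod (fun i : 'I_(size t) => t`_i) &
      forall z, z \in s -> span_mod (fun i : 'I_(size t) => t`_i) z].
Proof.
elim: s => [|z s [t [ts it st]]].
  by exists [::]; split=> // [c _ []].
have [zt|nz] := EM (span_mod (fun i : 'I_(size t) => t`_i) z).
  exists t; split=> [u /ts us|//|u]; rewrite inE ?us ?orbT //.
  by case/predU1P => [->|/st].
exists (z :: t); split=> [u|c|u].
- by rewrite !inE => /predU1P[->|/ts->]; rewrite ?eqxx ?orbT.
- rewrite big_ord_recl /= => Jc.
  have c0 : c ord0 = 0.
    apply: contrapT => /eqP nc; apply: nz.
    exists (fun i => - ((c ord0)^-1 * c (lift ord0 i))).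
    have -> : z - \sum_(i < size t) - ((c ord0)^-1 * c (lift ord0 i)) *: t`_i =
      (c ord0)^-1 *: (c ord0 *: z + \sum_(i < size t) c (lift ord0 i) *: t`_i).
      rewrite scalerDr scalerA mulVf // scale1r scaler_sumr -sumrN; congr (_ + _).
      by apply: eq_bigr => i _; rewrite scaleNr opprK scalerA.
    exact: JZ.
  rewrite c0 scale0r add0r in Jc.
  by move=> i; case: (unliftP ord0 i) => [j|] -> //; apply: (it (fun j => c (lift ord0 j))).
- rewrite inE => /predU1P[->|/st[c Jc]]; first exact: (span_mod_gen _ (ord0 : 'I_(size (z :: t)))).
  exists (fun i => if unlift ord0 i is Some j then c j else 0).
  rewrite big_ord_recl unlift_none scale0r add0r.
  by under eq_bigr do rewrite liftK.
Qed.
End IndependenceModulo.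

(** * Growth of the preprojective algebra *)

Section Pieces.
Variables (K : fieldType) (Q : quiver).
Local Notation DQ := (double_quiver Q).
Local Notation P := (path_alg K DQ).
Local Notation I := (ideal_gen (@preproj_rel K Q)).
Local Notation idem := (@path_idem K DQ).
Local Notation arr := (@path_arr K DQ).
Local Notation homog_part := (@homog_part K DQ).
Local Notation right_deriv := (@right_deriv K DQ).
Local Notation sgn := (@sgn Q K).
Local Notation rho := (@preproj_elt K Q).
Local Notation aug := (@aug K Q).
Implicit Types (w v : vertex DQ) (a b : arrow DQ).

(** Component in e_w P e_v. Degrees are shifted by one, so that [component 0] is
    zero: the growth estimate can then start from two terms 0 and 1. *)
Definition component n w v (x : P) : P :=
  if n is m.+1 then idem w * homog_part m x * idem v else 0.

Definition piece n w v (x : P) : Prop := component n w v x = x.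

Lemma componentP n w v : linear (component n w v).
Proof.
case: n => [|n] k x y /=; first by rewrite scaler0 addr0.
by rewrite homog_partP mulrDr mulrDl -scalerAr -scalerAl.
Qed.

HB.instance Definition _ n w v :=
  GRing.isLinear.Build K P P *:%R (component n w v) (componentP n w v).

Lemma preproj_ideal_component n w v x : I x -> I (component n w v x).
Proof. by case: n => [|n] Ix; [exact: preproj_ideal0 | by apply: preproj_idealMr; apply: preproj_idealMl; apply: preproj_ideal_homog]. Qed.

Lemma comp_piece n w v x : piece n w v (component n w v x).
Proof.
case: n => [//|n]; rewrite /piece /= homog_part_idem_r homog_part_idem_l homog_part_homog eqxx.
by rewrite !mulrA -[idem w * idem w]/(_ * _) idemM eqxx -mulrA idemM eqxx.
Qed.

Lemma piece0 w v x : piece 0 w v x -> x = 0. Proof. by move=> <-. Qed.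

Lemma pieceP n w v k x y : piece n w v x -> piece n w v y -> piece n w v (k *: x + y).
Proof. by rewrite /piece => px py; rewrite linearP /= px py. Qed.

Lemma piece_zero n w v : piece n w v 0. Proof. exact: linear0. Qed.

Lemma piece_idem n w v x : piece n w v x -> x * idem v = x.
Proof.
case: n => [|n] <- /=; first by rewrite mul0r.
by rewrite -mulrA idemM eqxx.
Qed.

Lemma comp_arr n w v x a :
  component n.+1 w v (x * arr a) = if v == tgt a then component n w (src a) x * arr a else 0.
Proof.
rewrite /= homog_part_arr_r; case: n => [|n].
  by rewrite mulr0 mul0r /= mul0r if_same.
rewrite -!mulrA arr_idem; case: eqP => _; last by rewrite !mulr0.
by rewrite idem_arr eqxx.
Qed.

Lemma piece_arr n w v x a : piece n w v x -> piece n.+1 w (tgt a) (x * arr a).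
Proof.
move=> px; rewrite /piece comp_arr eqxx -[in RHS](piece_idem px) -mulrA idem_arr.
case: eqP => [<-|/eqP nv]; first by rewrite px.
have -> : x = x * idem v by rewrite (piece_idem px).
have -> : component n w (src a) (x * idem v) = 0; last by rewrite mulr0 mul0r.
case: n px => [//|n] px; rewrite /= homog_part_idem_r -!mulrA idemM.
by rewrite (negPf nv) !mulr0.
Qed.

Lemma piece_arr_neq n w v x a : piece n w v x -> v != src a -> x * arr a = 0.
Proof.
by move=> /piece_idem <- /negPf nv; rewrite -mulrA idem_arr nv mulr0.
Qed.

Lemma idem_piece w : piece 1 w w (idem w).
Proof. by rewrite /piece /= homog_part_idem /= !idemM eqxx idemM eqxx. Qed.

Lemma aug_idem w : aug w (idem w) = 1 :> K.
Proof. by rewrite /path_idem path_eltE augU -val_eqE eqxx. Qed.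

Lemma aug_arr w a : aug w (arr a) = 0 :> K.
Proof.
have h : walk (src a) [:: a] by rewrite /= eqxx.
by rewrite /path_arr (path_eltE _ h) augU -val_eqE /= xpair_eqE andbF.
Qed.

Lemma preproj_ideal_aug w x : I x -> aug w x = 0.
Proof.
have a0 : aug w (0 : P) = 0 by apply: mcoeff0.
elim/preproj_ideal_ind => [//|k y z IHy IHz|a y IH|v y IH|a y IH|v y IH|].
- by rewrite augP IHy IHz mulr0 addr0.
- by rewrite augM IH mulr0.
- by rewrite augM IH mulr0.
- by rewrite augM IH mul0r.
- by rewrite augM IH mul0r.
rewrite rhoE; elim/big_ind: _ => // [y z ey ez|b _].
  by rewrite -[y]scale1r augP ey ez mulr0 addr0.
by rewrite -[_ *: _]addr0 augP augM aug_arr mul0r mulr0 add0r.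
Qed.

Lemma idem_notin w : ~ I (idem w).
Proof. by move=> /(preproj_ideal_aug w) /eqP; rewrite aug_idem oner_eq0. Qed.

Lemma piece_idem_l n w v x : piece n w v x -> idem w * x = x.
Proof.
case: n => [|n] <- /=; first by rewrite mulr0.
by rewrite !mulrA idemM eqxx.
Qed.

Lemma piece_homog n w v x : piece n.+1 w v x -> homog_part n x = x.
Proof. by move=> <- /=; rewrite homog_part_idem_r homog_part_idem_l homog_part_homog eqxx. Qed.

Lemma right_deriv_piece n w v t a : piece n.+1 w v t -> piece n w (src a) (right_deriv a t).
Proof.
move=> pt; case: n => [|n] in pt *.
  by rewrite -(piece_homog pt) right_deriv_homog0; apply: piece_zero.
by rewrite /piece /= homog_part_deriv (piece_homog pt) -mulrA right_deriv_src -right_deriv_idem_l (piece_idem_l pt).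
Qed.

Lemma right_deriv_neq n w v t a : piece n w v t -> v != tgt a -> right_deriv a t = 0.
Proof. by move=> /piece_idem <- /negPf nv; rewrite right_deriv_idem_r nv. Qed.

Lemma piece_deriv_sum n w v t : piece n.+2 w v t -> t = \sum_a right_deriv a t * arr a.
Proof. by move=> /piece_homog <-; apply: homog_part_deriv_sum. Qed.

(** [ideal_exact] with homogeneous data; the witness drops by one degree. *)
Lemma piece_exact n w (y : arrow DQ -> P) : (forall a, piece n.+1 w (src a) (y a)) ->
  I (\sum_a y a * arr a) ->
  exists p, forall a, I (y a + sgn a *: (component n w (tgt a) p * arr (star a))).
Proof.
move=> py /ideal_exact[p pE]; exists p => a.
have := preproj_ideal_component n.+1 w (src a) (pE a).
rewrite linearD linearZ /= -/(component n.+1 w (src a) _).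
have -> : component n.+1 w (src a) (y a * idem (src a)) = y a.
  by rewrite (piece_idem (py a)) py.
have := comp_arr n w (src a) p (star a).
by rewrite src_star tgt_star eqxx /= => ->.
Qed.

Lemma piece_basis n w v : exists t : seq P,
  [/\ forall x, x \in t -> piece n w v x,
      indep_mod I (fun i : 'I_(size t) => t`_i) &
      forall x, piece n w v x -> span_mod I (fun i : 'I_(size t) => t`_i) x].
Proof.
case: n => [|n].
  exists [::]; split=> [//|c _ []//|x /piece0->].
  by apply: span_mod0; apply: preproj_ideal0.
pose s := [seq component n.+1 w v (path_elt K w q) | q : n.-tuple (arrow DQ) <- enum {: n.-tuple (arrow DQ)}].
have [t [ts it st]] := basis_mod (@preproj_ideal0 K Q) (@ideal_genP K P _) s.
exists t; split=> [x xt|//|x <-].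
  by have /mapP[q _ ->] := ts _ xt; apply: comp_piece.
have span0 : span_mod I (fun i : 'I_(size t) => t`_i) 0.
  by apply: span_mod0; apply: preproj_ideal0.
elim/path_elt_ind: x => [|k x y IHx IHy|u q].
- by rewrite linear0.
- by rewrite linearP; apply: span_mod_lin => //; apply: ideal_genP.
have [eu|nu] := eqVneq w u; last first.
  by rewrite /= homog_part_path; case: ifP => _; rewrite ?mulr0 ?mul0r // /path_idem path_eltM /= (negPf nu) mul0r.
have [eq|nq] := eqVneq (size q) n; last by rewrite /= homog_part_path (negPf nq) mulr0 mul0r.
rewrite -eu; apply: st; apply/mapP.
by exists (Tuple (introT eqP eq)); rewrite ?mem_enum.
Qed.

Section GrowthStep.
Variables (w : vertex DQ) (bs : nat * vertex DQ -> seq P).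
Hypothesis bsP : forall nv : nat * vertex DQ,
  [/\ forall x, x \in bs nv -> piece nv.1 w nv.2 x,
      indep_mod I (fun i : 'I_(size (bs nv)) => (bs nv)`_i) &
      forall x, piece nv.1 w nv.2 x ->
        span_mod I (fun i : 'I_(size (bs nv)) => (bs nv)`_i) x].

Let L : lmodType K := {ffun arrow DQ -> P}.
Let J (f : L) : Prop := forall a, I (f a).

Lemma bs_piece n v (i : 'I_(size (bs (n, v)))) : piece n w v (bs (n, v))`_i.
Proof. by have [pb _ _] := bsP (n, v); apply: pb; rewrite mem_nth. Qed.

Lemma bs_span n v x : piece n w v x ->
  exists c : 'I_(size (bs (n, v))) -> K, I (x - \sum_i c i *: (bs (n, v))`_i).
Proof. by have [_ _ sb] := bsP (n, v) => px; have [c Ic] := sb _ px; exists c. Qed.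

(** The Golod-Shafarevich inequality. Right multiplication by arrows maps the sum
    of the pieces of degree m.+1 at the sources of the arrows a ending at v to
    the piece of degree m.+2 at v, and by [piece_exact] its kernel modulo I is
    the image of the piece of degree m at v. *)
Lemma growth_step m v :
  (\sum_(a : arrow DQ | tgt a == v) size (bs (m.+1, src a)) <=
   size (bs (m.+2, v)) + size (bs (m, v)))%N.
Proof.
pose ss a := if tgt a == v then bs (m.+1, src a) else [::].
pose T := {a : arrow DQ & 'I_(size (ss a))}.
pose U := ('I_(size (bs (m.+2, v))) + 'I_(size (bs (m, v))))%type.
have -> : (\sum_(a : arrow DQ | tgt a == v) size (bs (m.+1, src a)) = #|{: T}|)%N.
  rewrite card_tagged sumnE big_map big_enum big_mkcond /=.
  by apply: eq_bigr => a _; rewrite card_ord /ss; case: ifP.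
have -> : (size (bs (m.+2, v)) + size (bs (m, v)) = #|{: U}|)%N.
  by rewrite card_sum !card_ord.
(* [x] is the union of the bases at the neighbours, [y] consists of liftings
   of a basis in degree m.+2 and of the images of a basis in degree m. *)
pose x (t : T) : L := [ffun b => if b == tag t then (ss (tag t))`_(tagged t) else 0].
pose y (u : U) : L := match u with
  | inl i => [ffun a => right_deriv a (bs (m.+2, v))`_i]
  | inr j => [ffun a => sgn a *: ((bs (m, v))`_j * arr (star a))]
  end.
have J0 : J 0 by move=> a; rewrite ffunE; apply: preproj_ideal0.
have JP k f g : J f -> J g -> J (k *: f + g).
  by move=> Jf Jg a; rewrite !ffunE; apply: ideal_genP.
have iss a : indep_mod I (fun i : 'I_(size (ss a)) => (ss a)`_i).
  by rewrite /ss; case: ifP => _; [case: (bsP (m.+1, src a)) | move=> c _ []].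
have ssP a (i : 'I_(size (ss a))) : tgt a = v /\ piece m.+1 w (src a) (ss a)`_i.
  case: i => i; rewrite /ss /=; case: eqP => // -> li; split=> //.
  exact: (bs_piece (Ordinal li)).
apply: (indep_card_le J0 JP (x := x) (y := y)) => [c Jc [a i]|[a i]].
- apply: (iss a (fun i => c (Tagged (fun a => 'I_(size (ss a))) i))).
  have := Jc a; rewrite sum_ffunE.
  pose F b (j : 'I_(size (ss b))) : P :=
    c (Tagged (fun a => 'I_(size (ss a))) j) *: (if a == b then (ss b)`_j else 0).
  rewrite (eq_bigr (fun t : T => F (tag t) (tagged t))); last first.
    by move=> [b j] _; rewrite !ffunE.
  rewrite -(@sig_big_dep P 0 +%R _ (fun b => 'I_(size (ss b))) xpredT (fun b _ => true) F) /= (bigD1 a) //= /F eqxx.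
  rewrite [X in _ + X]big1 ?addr0 // => b nb; rewrite big1 // => k _.
  by rewrite eq_sym (negPf nb) scaler0.
have [ta pb] := ssP a i; set e_a := (ss a)`_i in pb *.
have [c Ic] : exists c : 'I_(size (bs (m.+2, v))) -> K,
    I (e_a * arr a - \sum_i c i *: (bs (m.+2, v))`_i).
  by apply: bs_span; have := piece_arr a pb; rewrite ta.
pose f b := (if b == a then e_a else 0) - \sum_i c i *: right_deriv b (bs (m.+2, v))`_i.
have pf b : piece m.+1 w (src b) (f b).
  rewrite /f addrC -scaleN1r; apply: pieceP; last first.
    by case: eqP => [->|_] //; apply: piece_zero.
  elim/big_ind: _ => [|z t pz pt|k _]; first exact: piece_zero.
    by rewrite -[z]scale1r; apply: pieceP.
  rewrite -[_ *: _]addr0; apply: pieceP; last exact: piece_zero.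
  by apply: right_deriv_piece; apply: bs_piece.
have sf : \sum_b f b * arr b = e_a * arr a - \sum_i c i *: (bs (m.+2, v))`_i.
  under eq_bigr do rewrite mulrBl; rewrite sumrB; congr (_ - _).
    rewrite (bigD1 a) //= eqxx big1 ?addr0 // => b /negPf->; exact: mul0r.
  under eq_bigr do rewrite mulr_suml; rewrite exchange_big; apply: eq_bigr => k _ /=.
  under eq_bigr do rewrite -scalerAl; rewrite -scaler_sumr; congr (_ *: _).
  exact/esym/piece_deriv_sum/bs_piece.
rewrite -sf in Ic; have [p pE] := piece_exact pf Ic.
have [d Id] := bs_span (comp_piece m w v p).
exists (fun u => match u with inl k => c k | inr k => - d k end) => b.
rewrite !ffunE sum_ffunE big_sumType /=.
under eq_bigr do rewrite !ffunE; rewrite opprD addrA.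
under [X in _ - X]eq_bigr do rewrite !ffunE.
rewrite -[X in X - _]/(f b).
have [tb|nb] := eqVneq (tgt b) v; last first.
  have -> : f b = 0.
    have ba : (b == a) = false.
      by apply/eqP => e; move: nb; rewrite e ta eqxx.
    rewrite /f ba.
    rewrite big1 ?subr0 // => k _.
    have -> : right_deriv b (bs (m.+2, v))`_k = 0.
      by apply: (right_deriv_neq (bs_piece k)); rewrite eq_sym.
    exact: scaler0.
  rewrite big1 ?subr0 => [|k _]; first exact: preproj_ideal0.
  by rewrite (piece_arr_neq (bs_piece k)) ?scaler0 // src_star eq_sym.
have := pE b; rewrite tb => I1.
have I2 := preproj_idealZ (sgn b) (preproj_idealMr (arr (star b)) Id).
have := preproj_idealB I1 I2; congr I.
rewrite mulrBl scalerBr opprB addrA addrAC addrK -sumrN; congr (_ + _).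
rewrite mulr_suml scaler_sumr; apply: eq_bigr => k _.
by rewrite scaleNr opprK -scalerAl !scalerA mulrC.
Qed.
End GrowthStep.

Section Growth.
Variable delta : vertex Q -> nat.
Hypothesis delta_gt0 : forall v, (0 < delta v)%N.
Hypothesis delta_harmonic : forall v : vertex DQ,
  (\sum_(a : arrow DQ | src a == v) delta (tgt a) = 2 * delta v)%N.

(** Summing [growth_step] with the weights [delta] gives
    2 s(m+1) <= s(m+2) + s(m), and s(0) = 0 < s(1); hence s increases strictly. *)
Lemma piece_growth n w : exists v x, piece n.+1 w v x /\ ~ I x.
Proof.
have [bs bsP] := @choice _ _ (fun (nv : nat * vertex DQ) t => _) (fun nv => piece_basis nv.1 w nv.2).
pose h n v := size (bs (n, v)).
have hineq m v : (\sum_(a : arrow DQ | tgt a == v) h m.+1 (src a) <= h m.+2 v + h m v)%N.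
  exact: growth_step.
pose s m := (\sum_v delta v * h m v)%N.
have s_conv m : (s m.+1 + s m.+1 <= s m.+2 + s m)%N.
  have -> : (s m.+1 + s m.+1 = \sum_v delta v * \sum_(a : arrow DQ | tgt a == v) h m.+1 (src a))%N.
    rewrite addnn -mul2n /s big_distrr /=.
    under eq_bigr => v _ do rewrite mulnA -delta_harmonic big_distrl /=.
    under [RHS]eq_bigr => v _ do rewrite big_distrr /=.
    rewrite (exchange_big_dep xpredT) // [RHS](exchange_big_dep xpredT) //.
    apply: eq_bigr => a _.
    rewrite (big_pred1 (@src DQ a)) => [|v]; last by rewrite eq_sym.
    by rewrite (big_pred1 (@tgt DQ a)) => [|v]; last by rewrite eq_sym.
  rewrite -big_split; apply: leq_sum => v _.
  by rewrite /= -mulnDr leq_mul2l hineq orbT.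
have h0 v : h 0%N v = 0%N.
  rewrite /h; have [pb ib _] := bsP (0%N, v).
  case E: (bs (0%N, v)) pb ib => [//|x t] pb ib.
  have /piece0 x0 : piece 0 w v x by apply: pb; rewrite inE eqxx.
  by case: (indep_mod_notin (t := ord0) ib); rewrite /= x0; apply: preproj_ideal0.
have s1 : (s 0%N < s 1%N)%N.
  rewrite {1}/s big1 => [|v _]; last by rewrite h0 muln0.
  rewrite /s (bigD1 w) //= addn_gt0 muln_gt0 delta_gt0 /=; apply/orP; left.
  rewrite lt0n; apply/negP => /eqP /size0nil e.
  have [_ _ /(_ _ (idem_piece w))] := bsP (1%N, w); rewrite e => -[c].
  by rewrite big_ord0 subr0; apply: idem_notin.
have s_incr m : (s m < s m.+1)%N.
  elim: m => // m IH; have := s_conv m; lia.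
have : (0 < s n.+1)%N by apply: leq_ltn_trans (s_incr n).
rewrite lt0n sum_nat_eq0 negb_forall => /existsP[v]; rewrite muln_eq0 negb_or => /andP[_ hv].
have [pb ib _] := bsP (n.+1, v); exists v, (bs (n.+1, v))`_0.
have hv' : (0 < h n.+1 v)%N by rewrite lt0n.
split; first by apply: pb; rewrite mem_nth.
exact: (indep_mod_notin (t := Ordinal hv') ib).
Qed.
End Growth.
End Pieces.

(** * The right socle *)

Section Socle.
Variables (K : fieldType) (Q : quiver).
Local Notation DQ := (double_quiver Q).
Local Notation P := (path_alg K DQ).
Local Notation I := (ideal_gen (@preproj_rel K Q)).
Local Notation idem := (@path_idem K DQ).
Local Notation arr := (@path_arr K DQ).
Local Notation homog_part := (@homog_part K DQ).
Local Notation right_deriv := (@right_deriv K DQ).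
Local Notation sgn := (@sgn Q K).
Local Notation rho := (@preproj_elt K Q).
Local Notation component := (@component K Q).
Local Notation piece := (@piece K Q).
Implicit Types (w v : vertex DQ) (a b : arrow DQ).

(** The linear form is a coordinate of the projection onto a complement of I. *)
Lemma separating_functional (z : P) : ~ I z -> exists l : P -> K,
  [/\ forall k x y, l (k *: x + y) = k * l x + l y, forall x, I x -> l x = 0 & l z = 1].
Proof.
move=> nIz; have [p [pI p0]] := subspace_projection (@preproj_ideal0 K Q) (@ideal_genP K P _).
have pz : p z <> 0 by move=> e; apply: nIz; have := pI z; rewrite e subr0.
have [q nq] : exists q, mcoeff q (p z : {malg K[_]}) != 0.
  apply: contrapT => nq; apply: pz; apply/malgP => q; rewrite mcoeff0.
  by apply/eqP; apply: contrapT => /negP h; apply: nq; exists q.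
exists (fun x => mcoeff q (p x : {malg K[_]}) / mcoeff q (p z : {malg K[_]})); split.
- move=> k x y; rewrite linearP.
  have -> : mcoeff q (k *: p x + p y : {malg K[_]}) = k * mcoeff q (p x : {malg K[_]}) + mcoeff q (p y : {malg K[_]}).
    by rewrite mcoeffD mcoeffZ.
  by rewrite mulrDl mulrA.
- by move=> x /p0 ->; rewrite mcoeff0 mul0r.
- by rewrite divff.
Qed.

(** The right action of a word that need not be a walk. *)
Definition act_word (y : P) (s : seq (arrow DQ)) : P := foldl (fun y a => y * arr a) y s.

Lemma act_wordE s : exists t, forall y, act_word y s = y * t.
Proof.
elim: s => [|a s [t IH]]; first by exists 1 => y'; rewrite mulr1.
by exists (arr a * t) => y'; rewrite mulrA /= IH.
Qed.

Lemma act_word_lin s : linear (fun y => act_word y s).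
Proof. by move=> k x y; have [t tE] := act_wordE s; rewrite !tE mulrDl -scalerAl. Qed.

Lemma preproj_ideal_act y s : I y -> I (act_word y s).
Proof. by have [t ->] := act_wordE s; apply: preproj_idealMr. Qed.

Lemma act_word_idem w s : act_word (idem w) s = path_elt K w s.
Proof.
elim/last_ind: s => // s a IH.
by rewrite path_elt_rcons -IH /act_word foldl_rcons.
Qed.

Lemma piece_diff n w u v x : piece n w v x -> v != u -> component n w u x = 0.
Proof.
case: n => [//|n] /piece_idem <- /negPf vu.
by rewrite /= homog_part_idem_r -!mulrA idemM vu !mulr0.
Qed.

Lemma piece1 w v x : piece 1 w v x -> exists c, x = c *: idem w.
Proof.
move=> <-; elim/path_elt_ind: x => [|k x y [c IHx] [d IHy]|u s].
- by exists 0; rewrite linear0 scale0r.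
- by exists (k * c + d); rewrite componentP IHx IHy scalerDl scalerA.
rewrite /= homog_part_path; case: s => [|a s] /=; last by exists 0; rewrite mulr0 mul0r scale0r.
rewrite -/(idem u) idemM; case: eqP => _; last by exists 0; rewrite mul0r scale0r.
rewrite idemM; case: eqP => _; last by exists 0; rewrite scale0r.
by exists 1; rewrite scale1r.
Qed.

Section Brick.
Variables (w : vertex DQ) (n : nat).
Hypothesis socle_lt : forall m v z, (m < n)%N -> piece m w v z ->
  (forall a, I (z * arr a)) -> I z.

Lemma socle_lt_act j k v r : (k + j <= n)%N -> piece k w v r ->
  (forall s, size s = j -> I (act_word r s)) -> I r.
Proof.
elim: j k v r => [|j IH] k v r le pr_ h; first exact: (h [::]).
apply: (socle_lt (m := k) _ pr_) => [|a]; first by lia.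
apply: (IH k.+1 (tgt a)); first by lia.
  exact: (piece_arr a pr_).
by move=> s es; apply: (h (a :: s)); rewrite /= es.
Qed.

Variables (u : vertex DQ) (z : P).
Hypothesis pz : piece n w u z.
Hypothesis za : forall a, I (z * arr a).
Variable l : P -> K.
Hypothesis lP : forall k x y, l (k *: x + y) = k * l x + l y.
Hypothesis lI : forall x, I x -> l x = 0.
Hypothesis lu : forall v x, piece n w v x -> v != u -> l x = 0.

(** The rank one map x |-> l x * z in degree n commutes with the arrows, since
    [z] is killed by them. Given y in degree k, one looks for its image y' under
    an extension to degree k: the images of the y b are known, and they satisfy
    the relation because sum_b eps_b y b b' lies in I and no lower degree has a
    socle; exactness then produces y'. *)
Lemma endomorphism_descent j k v y : (k + j = n)%N -> piece k w v y ->
  exists y', piece k w v y' /\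
    forall s, size s = j -> I (act_word y' s - l (act_word y s) *: z).
Proof.
have l0 : l 0 = 0 by apply: lI; apply: preproj_ideal0.
elim: j k v y => [|j IH] k v y kn py.
  rewrite addn0 in kn; rewrite kn in py *.
  exists (l y *: z); split; last by move=> [|//] _; rewrite subrr; apply: preproj_ideal0.
  have [->|nv] := eqVneq v u; last by rewrite (lu py nv) scale0r; apply: piece_zero.
  by rewrite -[_ *: _]addr0; apply: pieceP => //; apply: piece_zero.
(* [Y a] is the image of y * a; it is set to 0 where y * a vanishes for lack
   of composability. *)
have [a|Y YP] := @choice (arrow DQ) P (fun a y' => [/\ piece k.+1 w (tgt a) y',
    forall s, size s = j -> I (act_word y' s - l (act_word (y * arr a) s) *: z) &
    v != src a -> y' = 0]).
  have [e|ne] := eqVneq v (src a).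
    have [y' [py' yE]] := IH k.+1 (tgt a) (y * arr a) ltac:(lia) (piece_arr a py).
    by exists y'.
  exists 0; split=> // [|s _]; first exact: piece_zero.
  rewrite (piece_arr_neq py ne) (linear_fun0 (act_word_lin s)) l0 scale0r subrr; exact: preproj_ideal0.
have pY a : piece k.+1 w (tgt a) (Y a) by case: (YP a).
pose r := \sum_a sgn a *: (Y a * arr (star a)).
have pr_ : piece k.+2 w v r.
  rewrite /r; elim/big_ind: _ => [|x t px pt|a _]; first exact: piece_zero.
    by rewrite -[x]scale1r; apply: pieceP.
  rewrite -[_ *: _]addr0; apply: pieceP; last exact: piece_zero.
  have [->|ne] := eqVneq v (src a).
    by have := piece_arr (star a) (pY a); rewrite tgt_star.
  by have [_ _ ->] := YP a; rewrite // mul0r; apply: piece_zero.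
(* In degree n the sum vanishes because the arrows kill z; in lower degrees
   because it is annihilated by all words that lead to degree n. *)
have Ir : I r.
  case: j => [|j] in IH kn YP *.
    apply: preproj_ideal_sum => a; apply: preproj_idealZ.
    have [_ /(_ [::] erefl) /= Ia _] := YP a.
    rewrite -[Y a](subrK (l (y * arr a) *: z)) mulrDl; apply: preproj_idealD; first exact: preproj_idealMr.
    by rewrite -scalerAl; apply: preproj_idealZ.
  apply: (socle_lt_act (k := k.+2) (j := j) (v := v)) => // [|s es]; first lia.
  have [t tE] := act_wordE s; rewrite tE.
  have lsum (c : arrow DQ -> K) (X : arrow DQ -> P) :
      l (\sum_a c a *: X a) = \sum_a c a * l (X a).
    apply: (big_ind2 (fun x k => l x = k)) => [//|x1 k1 x2 k2 e1 e2|a _].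
      by rewrite -[x1]scale1r lP e1 e2 mul1r.
    by rewrite -[_ *: _]addr0 lP l0 addr0.
  have ez : \sum_a sgn a * l (y * arr a * arr (star a) * t) = 0.
    rewrite -lsum; apply: lI.
    have := preproj_idealMr t (preproj_idealMl y (@preproj_elt_ideal K Q)); rewrite rhoE mulr_sumr mulr_suml.
    by congr I; apply: eq_bigr => a _; rewrite -scalerAr -scalerAl !mulrA.
  have -> : r * t = \sum_a sgn a *: (Y a * arr (star a) * t -
      l (y * arr a * arr (star a) * t) *: z).
    have ezz : \sum_a (- (sgn a * l (y * arr a * arr (star a) * t))) *: z = 0.
      by rewrite -(scaler_suml z) sumrN ez oppr0 scale0r.
    have rt : r * t = \sum_a sgn a *: (Y a * arr (star a) * t).
      by rewrite /r mulr_suml; apply: eq_bigr => a _; rewrite -scalerAl.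
    rewrite rt -[LHS]addr0 -[X in _ + X]ezz -big_split; apply: eq_bigr => a _ /=.
    by rewrite scalerBr scalerA scaleNr.
  apply: preproj_ideal_sum => a; apply: preproj_idealZ; have [_ /(_ (star a :: s)) /= Ia _] := YP a.
  by rewrite !tE in Ia; apply: Ia; rewrite es.
have : I (\sum_a (sgn (star a) *: Y (star a)) * arr a).
  move: Ir; congr I; rewrite /r (reindex_inj (inv_inj (@starK Q))).
  by apply: eq_bigr => a _; rewrite starK -scalerAl.
move/(piece_exact (n := k) (w := w)) => [a|p pE].
  rewrite -[_ *: _]addr0; apply: pieceP; last exact: piece_zero.
  by have := pY (star a); rewrite tgt_star.
have yE b : I (component k w v p * arr b - Y b).
  have [e|ne] := eqVneq v (src b); last first.
    have [_ _ ->] := YP b; rewrite // (piece_arr_neq (comp_piece _ _ _ _) ne) subrr.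
    exact: preproj_ideal0.
  have e1 (x x2 : P) : - sgn b *: (sgn b *: x + sgn (star b) *: x2) = x2 - x.
    rewrite sgn_star (scaleNr (sgn b) x2) -scalerBr scaleNr scalerA sgnK scale1r.
    exact: opprB.
  have := preproj_idealZ (- sgn b) (pE (star b)).
  by rewrite starK e1 tgt_star -e.
exists (component k w v p); split=> [|[//|b s] [es]]; first exact: comp_piece.
have [_ /(_ _ es) I1 _] := YP b.
have I2 := preproj_ideal_act s (yE b).
have := preproj_idealD I2 I1; congr I; have [t tE] := act_wordE s.
by rewrite /= !tE mulrBl addrA subrK.
Qed.

(** In degree 0 the extension is a scalar c on e_w, hence c x = l x * z for all x
    of degree n; taking x = z gives c = 1. *)
Lemma brick_row x v : (0 < n)%N -> l z = 1 -> ~ I z -> piece n w v x -> I (x - l x *: z).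
Proof.
move=> n0 lz nIz px; have l0 : l 0 = 0 by apply: lI; apply: preproj_ideal0.
have [y' [/piece1[c ->] yE]] :=
  endomorphism_descent (j := n.-1) (k := 1) ltac:(lia) (idem_piece K w).
have key m (t : P) : m = n.-1 -> I (c *: (idem w * homog_part m t) - l (idem w * homog_part m t) *: z).
  move=> em; elim/path_elt_ind: t => [|k g h IHg IHh|u' s].
  - by rewrite linear0 mulr0 scaler0 l0 scale0r subrr; apply: preproj_ideal0.
  - have e := scaled_difference k c (l (idem w * homog_part m g)) (l (idem w * homog_part m h))
      (idem w * homog_part m g) (idem w * homog_part m h) z.
    rewrite homog_partP mulrDr -scalerAr lP.
    rewrite [X in I X]e.
    apply: preproj_idealD => //.
    exact: (preproj_idealZ k IHg).
  rewrite homog_part_path; case: eqP => [es|_]; last first.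
    by rewrite mulr0 scaler0 l0 scale0r subrr; apply: preproj_ideal0.
  have [<-|nu] := eqVneq w u'; last first.
    have -> : idem w * path_elt K u' s = 0 by rewrite /path_idem path_eltM /= (negPf nu).
    by rewrite scaler0 l0 scale0r subrr; apply: preproj_ideal0.
  have -> : idem w * path_elt K w s = act_word (idem w) s.
    by rewrite act_word_idem /path_idem path_eltM /= eqxx.
  have := yE s; rewrite es em => /(_ erefl); congr (I (_ - _)).
  by have [t tE] := act_wordE s; rewrite !tE -scalerAl.
have keyx v' x' : piece n w v' x' -> I (c *: x' - l x' *: z).
  move=> px'; have e : idem w * homog_part n.-1 x' = x'.
    by rewrite (piece_homog (w := w) (v := v')) ?prednK // (piece_idem_l px').
  by have := key _ x' erefl; rewrite e.
have c1 : c = 1.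
  apply: contrapT => nc; apply: nIz; have nc1 : c - 1 != 0 by rewrite subr_eq0; apply/eqP.
  have := preproj_idealZ (c - 1)^-1 (keyx _ _ pz).
  by rewrite lz -scalerBl scalerA mulVf // scale1r.
by have := keyx _ _ px; rewrite c1 scale1r.
Qed.
End Brick.

Hypothesis growth : forall n w, exists v x, piece n.+1 w v x /\ ~ I x.

(** By [brick_row] a first socle element spans its degree, so that the next degree
    vanishes; this contradicts the growth. *)
Lemma socle_piece n w v z : piece n w v z -> (forall a, I (z * arr a)) -> I z.
Proof.
elim/ltn_ind: n v z => n IH v z pz za; apply: contrapT => nIz.
case: n => [|n] in IH pz *; first by apply: nIz; rewrite (piece0 pz); apply: preproj_ideal0.
have [l0 [l0P l0I l0z]] := separating_functional nIz.
pose l x := l0 (component n.+1 w v x).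
have lP k x y : l (k *: x + y) = k * l x + l y by rewrite /l componentP l0P.
have lI x : I x -> l x = 0 by move=> Ix; apply: l0I; apply: preproj_ideal_component.
have lu v' x : piece n.+1 w v' x -> v' != v -> l x = 0.
  by move=> px nv; rewrite /l (piece_diff px nv); apply: l0I; apply: preproj_ideal0.
have lz : l z = 1 by rewrite /l pz.
have [v' [x [px nIx]]] := growth n.+1 w; apply: nIx.
rewrite (piece_deriv_sum px); apply: preproj_ideal_sum => a.
have pa := right_deriv_piece a px.
have Ia := brick_row (fun m v z lt => IH m lt v z) pz za lP lI lu (ltn0Sn n) lz nIz pa.
move: (right_deriv a x) Ia => y Ia.
have -> : y * arr a = (y - l y *: z) * arr a + l y *: (z * arr a).
  by rewrite scalerAl -mulrDl subrK.
exact: preproj_idealD (preproj_idealMr (arr a) Ia) (preproj_idealZ (l y) (za a)).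
Qed.
End Socle.

(** * The bimodule map on the preprojective ideal *)

Section RelationMap.
Variables (K : fieldType) (Q : quiver).
Local Notation DQ := (double_quiver Q).
Local Notation P := (path_alg K DQ).
Local Notation I := (ideal_gen (@preproj_rel K Q)).
Local Notation idem := (@path_idem K DQ).
Local Notation arr := (@path_arr K DQ).
Local Notation homog_part := (@homog_part K DQ).
Local Notation right_deriv := (@right_deriv K DQ).
Local Notation sgn := (@sgn Q K).
Local Notation rho := (@preproj_elt K Q).
Local Notation component := (@component K Q).
Implicit Types (w v : vertex DQ) (a b : arrow DQ).

Hypothesis growth : forall n w, exists v x, piece n.+1 w v x /\ ~ I x.

Lemma socle_free x : (forall a, I (x * arr a)) -> I x.
Proof.
move=> xa; apply: preproj_ideal_of_homog => n.
have -> : homog_part n x = \sum_w \sum_v component n.+1 w v x.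
  under eq_bigr do rewrite -mulr_sumr sum_idem mulr1.
  by rewrite -mulr_suml sum_idem mul1r.
apply: preproj_ideal_sum => w; apply: preproj_ideal_sum => v.
apply: (socle_piece growth (comp_piece n.+1 w v x)) => a.
have [->|nv] := eqVneq v (src a).
  have := preproj_ideal_component n.+2 w (tgt a) (xa a).
  by rewrite comp_arr eqxx.
by rewrite (piece_arr_neq (comp_piece _ _ _ _) nv); apply: preproj_ideal0.
Qed.

(** The elements p of degree n - 1, those for which p * rho has degree n.+1. *)
Definition homog_part_shift (n : nat) (x : P) : P := if n is m.+1 then homog_part m x else 0.

(** The graph of the map D sending p rho q to p q, in degree n, modulo I. It is a
    relation because the element p of a decomposition p rho + sum_a U_a a is
    determined modulo I only, and only in the absence of a socle. *)
Fixpoint relation_graph (n : nat) (u x : P) : Prop :=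
  if n is m.+1 then
    exists p, exists U, exists X,
      [/\ homog_part_shift m p = p, forall a, relation_graph m (U a) (X a),
          u = p * rho + \sum_a U a * arr a & I (x - (p + \sum_a X a * arr a))]
  else u = 0 /\ I x.

Lemma homog_part_shiftP n : linear (homog_part_shift n).
Proof. by case: n => [|n] k x y /=; rewrite ?scaler0 ?addr0 // homog_partP. Qed.

Lemma relation_graph_lin n k (u v x y : P) : relation_graph n u x -> relation_graph n v y ->
  relation_graph n (k *: u + v) (k *: x + y).
Proof.
elim: n u v x y => [|n IH] u v x y /=.
  move=> [-> Ix] [-> Iy]; rewrite scaler0 addr0; split=> //.
  by apply: preproj_idealD => //; apply: preproj_idealZ.
move=> [p [U [X [pp UX -> Ix]]]] [q [V [Y [qq VY -> Iy]]]].
exists (k *: p + q), (fun a => k *: U a + V a), (fun a => k *: X a + Y a).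
have lin_sum (F G : arrow DQ -> P) : \sum_a (k *: F a + G a) * arr a =
    k *: (\sum_a F a * arr a) + \sum_a G a * arr a.
  rewrite scaler_sumr -big_split; apply: eq_bigr => a _ /=.
  by rewrite mulrDl -scalerAl.
split=> [|a||]; [by rewrite homog_part_shiftP pp qq|exact: IH| |].
  by rewrite lin_sum mulrDl -scalerAl scalerDr addrACA.
rewrite lin_sum; have := preproj_idealD (preproj_idealZ k Ix) Iy; congr I.
by rewrite scalerBr scalerDr addrACA -opprD; congr (_ - _); rewrite addrACA.
Qed.

Lemma relation_graph0_ideal n x : I x -> relation_graph n 0 x.
Proof.
elim: n x => [|n IH] x Ix //=; exists 0, (fun => 0), (fun => 0).
have s0 : \sum_a 0 * arr a = 0 by rewrite big1 // => a _; rewrite mul0r.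
split=> [|a||]; first exact: (linear_fun0 (homog_part_shiftP n)).
- by apply: IH; apply: preproj_ideal0.
- by rewrite s0 mul0r addr0.
- by rewrite s0 addr0 subr0.
Qed.

Lemma relation_graph00 n : relation_graph n 0 0. Proof. by apply: relation_graph0_ideal; apply: preproj_ideal0. Qed.

Lemma relation_graph_ideal n u x : relation_graph n u x -> I u.
Proof.
elim: n u x => [|n IH] u x /=; first by move=> [-> _]; apply: preproj_ideal0.
move=> [p [U [X [_ UX -> _]]]]; apply: preproj_idealD; first by apply: preproj_idealMl; apply: preproj_elt_ideal.
by apply: preproj_ideal_sum => a; apply: preproj_idealMr; apply: IH (UX a).
Qed.

Lemma relation_graph_arr_r n u x b : relation_graph n u x -> relation_graph n.+1 (u * arr b) (x * arr b).
Proof.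
move=> g; exists 0, (fun a => if a == b then u else 0), (fun a => if a == b then x else 0).
have S (z : P) : \sum_a (if a == b then z else 0) * arr a = z * arr b.
  by rewrite (bigD1 b) //= eqxx big1 ?addr0 // => a /negPf->; rewrite mul0r.
split=> [|a||]; first exact: (linear_fun0 (homog_part_shiftP n)).
- by case: (a == b) => //; apply: relation_graph00.
- by rewrite S mul0r add0r.
- by rewrite S add0r subrr; apply: preproj_ideal0.
Qed.

Lemma relation_graph_idem_r n u x v : relation_graph n u x -> relation_graph n (u * idem v) (x * idem v).
Proof.
case: n => [[-> Ix]|n].
  by rewrite mul0r; split=> //; apply: preproj_idealMr.
move=> [p [U [X [pp UX -> Ix]]]].
have S (F : arrow DQ -> P) : (\sum_a F a * arr a) * idem v =
    \sum_a (if v == tgt a then F a else 0) * arr a.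
  rewrite mulr_suml; apply: eq_bigr => a _; rewrite -mulrA arr_idem.
  by case: ifP; rewrite ?mulr0 ?mul0r.
exists (p * idem v), (fun a => if v == tgt a then U a else 0),
  (fun a => if v == tgt a then X a else 0); split=> [|a||].
- case: n pp {UX} => [|n] /= pp; last by rewrite homog_part_idem_r pp.
  by rewrite -pp mul0r.
- by case: (v == tgt a); [apply: UX | apply: relation_graph00].
- by rewrite mulrDl S -!mulrA idem_rho.
- by have := preproj_idealMr (idem v) Ix; rewrite mulrBl mulrDl S.
Qed.

Lemma relation_graph_arr_l n u x b : relation_graph n u x -> relation_graph n.+1 (arr b * u) (arr b * x).
Proof.
elim: n u x => [u x [-> Ix]|n IH u x].
  by rewrite mulr0; apply: relation_graph0_ideal; apply: preproj_idealMl.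
move=> [p [U [X [pp UX -> Ix]]]].
exists (arr b * p), (fun a => arr b * U a), (fun a => arr b * X a).
have S (F : arrow DQ -> P) : arr b * (\sum_a F a * arr a) = \sum_a arr b * F a * arr a.
  by rewrite mulr_sumr; apply: eq_bigr => a _; rewrite mulrA.
split=> [|a||]; last by have := preproj_idealMl (arr b) Ix; rewrite mulrBr mulrDr S.
- rewrite /= homog_part_arr_l; case: n pp {IH UX} => [|n] /= pp; last by rewrite pp.
  by rewrite -pp mulr0.
- by apply: IH; apply: UX.
- by rewrite mulrDr S mulrA.
Qed.

Lemma relation_graph_idem_l n u x v : relation_graph n u x -> relation_graph n (idem v * u) (idem v * x).
Proof.
elim: n u x => [u x [-> Ix]|n IH u x].
  by rewrite mulr0; apply: relation_graph0_ideal; apply: preproj_idealMl.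
move=> [p [U [X [pp UX -> Ix]]]].
exists (idem v * p), (fun a => idem v * U a), (fun a => idem v * X a).
have S (F : arrow DQ -> P) : idem v * (\sum_a F a * arr a) = \sum_a idem v * F a * arr a.
  by rewrite mulr_sumr; apply: eq_bigr => a _; rewrite mulrA.
split=> [|a||]; last by have := preproj_idealMl (idem v) Ix; rewrite mulrBr mulrDr S.
- case: n pp {IH UX} => [|n] /= pp; last by rewrite homog_part_idem_l pp.
  by rewrite -pp mulr0.
- by apply: IH; apply: UX.
- by rewrite mulrDr S mulrA.
Qed.

Lemma homog_part1 n : homog_part n (1 : P) = if n == 0%N then 1 else 0.
Proof.
rewrite -sum_idem linear_sum /=; case: eqP => [->|/eqP/negPf n0].
  by apply: eq_bigr => v _; rewrite homog_part_idem.
by rewrite big1 // => v _; rewrite homog_part_idem n0.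
Qed.

Lemma relation_graph_rho : relation_graph 2 rho 1.
Proof.
exists 1, (fun => 0), (fun => 0).
have s0 : \sum_a 0 * arr a = 0 by rewrite big1 // => a _; rewrite mul0r.
split=> [|a||]; first by rewrite /= homog_part1.
- exact: relation_graph00.
- by rewrite s0 mul1r addr0.
- by rewrite s0 addr0 subrr; apply: preproj_ideal0.
Qed.

(** All degrees together; D lowers the degree by two. *)
Definition graded_graph (u x : P) : Prop :=
  forall n, relation_graph n (homog_part n u) (if n is m.+2 then homog_part m x else 0).

Lemma graded_graph0 : graded_graph 0 0.
Proof. by move=> n; rewrite linear0; case: n => [|[|n]]; rewrite ?linear0; apply: relation_graph00. Qed.

Lemma graded_graph_lin k (u v x y : P) : graded_graph u x -> graded_graph v y ->
  graded_graph (k *: u + v) (k *: x + y).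
Proof.
move=> gu gv n; rewrite homog_partP; have := relation_graph_lin k (gu n) (gv n).
by case: n => [|[|n]]; rewrite ?scaler0 ?addr0 ?homog_partP.
Qed.

Lemma graded_graph_arr_l u x b : graded_graph u x -> graded_graph (arr b * u) (arr b * x).
Proof.
move=> g [|n]; rewrite homog_part_arr_l; first exact: relation_graph00.
have := relation_graph_arr_l b (g n); case: n => [|[|n]]; rewrite ?mulr0 //.
  by rewrite homog_part_arr_l.
by rewrite homog_part_arr_l.
Qed.

Lemma graded_graph_arr_r u x b : graded_graph u x -> graded_graph (u * arr b) (x * arr b).
Proof.
move=> g [|n]; rewrite homog_part_arr_r; first exact: relation_graph00.
have := relation_graph_arr_r b (g n); case: n => [|[|n]]; rewrite ?mul0r //.
  by rewrite homog_part_arr_r.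
by rewrite homog_part_arr_r.
Qed.

Lemma graded_graph_idem_l u x v : graded_graph u x -> graded_graph (idem v * u) (idem v * x).
Proof.
move=> g n; rewrite homog_part_idem_l; have := relation_graph_idem_l v (g n).
by case: n => [|[|n]]; rewrite ?mulr0 // homog_part_idem_l.
Qed.

Lemma graded_graph_idem_r u x v : graded_graph u x -> graded_graph (u * idem v) (x * idem v).
Proof.
move=> g n; rewrite homog_part_idem_r; have := relation_graph_idem_r v (g n).
by case: n => [|[|n]]; rewrite ?mul0r // homog_part_idem_r.
Qed.

Lemma graded_graph_rho : graded_graph rho 1.
Proof.
move=> n; rewrite homog_part_rho; case: n => [|[|[|n]]]; try exact: relation_graph00.
  by rewrite homog_part1; apply: relation_graph_rho.
by rewrite homog_part1; apply: relation_graph00.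
Qed.

Lemma graded_graph_mull y u x : graded_graph u x -> graded_graph (y * u) (y * x).
Proof.
elim/path_indl: y u x => [|k g h IHg IHh|v|y b IH] u x gu.
- by rewrite !mul0r; apply: graded_graph0.
- by rewrite !mulrDl -!scalerAl; apply: graded_graph_lin; [apply: IHg | apply: IHh].
- exact: graded_graph_idem_l.
- by rewrite -!mulrA; apply: graded_graph_arr_l; apply: IH.
Qed.

Lemma graded_graph_mulr y u x : graded_graph u x -> graded_graph (u * y) (x * y).
Proof.
elim/path_indr: y u x => [|k g h IHg IHh|v|y b IH] u x gu.
- by rewrite !mulr0; apply: graded_graph0.
- by rewrite !mulrDr -!scalerAr; apply: graded_graph_lin; [apply: IHg | apply: IHh].
- exact: graded_graph_idem_r.
- by rewrite !mulrA; apply: graded_graph_arr_r; apply: IH.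
Qed.

Lemma graded_graph_total u : I u -> exists x, graded_graph u x.
Proof.
elim/preproj_ideal_ind => [|k x y [x' gx] [y' gy]|a x [x' gx]|v x [x' gx]|a x [x' gx]|v x [x' gx]|].
- by exists 0; apply: graded_graph0.
- by exists (k *: x' + y'); apply: graded_graph_lin.
- by exists (arr a * x'); apply: graded_graph_arr_l.
- by exists (idem v * x'); apply: graded_graph_idem_l.
- by exists (x' * arr a); apply: graded_graph_arr_r.
- by exists (x' * idem v); apply: graded_graph_idem_r.
- by exists 1; apply: graded_graph_rho.
Qed.

(** If 0 = p rho + sum_a U_a a, then U_a is eps_a p a', so that p is in the socle
    and hence in I. Since D p is then defined, D (U_a) = eps_a (D p) a' by
    induction, and sum_a D (U_a) a is a multiple of rho modulo I. *)
Lemma relation_graph_functional n x : relation_graph n 0 x -> I x.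
Proof.
elim: n x => [|n IH] x; first by case.
move=> [p [U [X [pp UX' e Ix]]]].
have UX a : relation_graph n (U a) (X a) := UX' a.
have Ue a : U a * idem (src a) = sgn a *: (p * arr (star a)).
  have /(congr1 (right_deriv a)) := e; rewrite linear0 linearD /= right_deriv_rho linear_sum /=.
  rewrite (bigD1 a) //= right_deriv_arr eqxx big1 ?addr0 => [|b /negPf nb]; last first.
    by rewrite right_deriv_arr nb.
  by move/esym/eqP; rewrite scaleNr addrC subr_eq0 => /eqP.
have Ip : I p.
  apply: socle_free => b.
  have := preproj_idealZ (sgn (star b)) (preproj_idealMr (idem (src (star b))) (relation_graph_ideal (UX (star b)))).
  by rewrite Ue scalerA sgnK scale1r starK.
suff IX : I (\sum_a X a * arr a).
  by have := preproj_idealD Ix (preproj_idealD Ip IX); rewrite subrK.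
clear UX'; case: n => [|n] in IH pp UX *.
  by apply: preproj_ideal_sum => a; apply: preproj_idealMr; case: (UX a).
have [x'' gx'] : exists x'', relation_graph n p x''.
  by have [x' /(_ n)] := graded_graph_total Ip; rewrite -/(homog_part_shift n.+1 p) pp => gx'; eexists; apply: gx'.
have Ia a : I (X a * idem (src a) - sgn a *: (x'' * arr (star a))).
  apply: IH; have := relation_graph_lin (- sgn a) (relation_graph_arr_r (star a) gx') (relation_graph_idem_r (src a) (UX a)).
  rewrite Ue scaleNr addNr; congr (relation_graph _ _ _).
  by rewrite scaleNr addrC.
have := preproj_ideal_sum (fun a => preproj_idealMr (arr a) (Ia a)).
have -> : \sum_a (X a * idem (src a) - sgn a *: (x'' * arr (star a))) * arr a =
    \sum_a X a * arr a + x'' * rho.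
  have srho : \sum_a - (sgn a *: (x'' * arr (star a)) * arr a) = x'' * rho.
    rewrite rhoE mulr_sumr (reindex_inj (inv_inj (@starK Q))); apply: eq_bigr => a _.
    by rewrite starK sgn_star scaleNr mulNr opprK -scalerAl -scalerAr mulrA.
  rewrite -srho -big_split; apply: eq_bigr => a _ /=.
  by rewrite mulrBl -mulrA idem_arr eqxx.
by move=> /preproj_idealB /(_ (preproj_idealMl x'' (@preproj_elt_ideal K Q))); rewrite addrK.
Qed.

Lemma graded_graph_functional (x : P) : graded_graph 0 x -> I x.
Proof.
move=> g; apply: preproj_ideal_of_homog => n; apply: (relation_graph_functional (n := n.+2)).
by have := g n.+2; rewrite linear0.
Qed.

Lemma relation_map : exists D : P -> quot_alg (@preproj_rel_proper K Q),
  [/\ forall k x y, I x -> I y -> D (k *: x + y) = k *: D x + D y,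
      forall p x, I x -> D (p * x) = quot_pi _ p * D x,
      forall p x, I x -> D (x * p) = D x * quot_pi _ p &
      D rho = 1].
Proof.
pose pi := quot_pi (@preproj_rel_proper K Q).
have [u|d dP] := @choice P P (fun u x => I u -> graded_graph u x).
  by have [/graded_graph_total[x gx]|nI] := EM (I u); [exists x | exists 0].
have pid u x : I u -> graded_graph u x -> pi (d u) = pi x.
  move=> Iu gx; apply/(quot_pi_eq (@preproj_rel_proper K Q)); apply: graded_graph_functional.
  have := graded_graph_lin (-1) gx (dP _ Iu); rewrite !scaleN1r addNr.
  by congr graded_graph; rewrite addrC.
exists (fun u => pi (d u)); split=> [k x y Ix Iy|p x Ix|p x Ix|].
- rewrite (pid _ (k *: d x + d y)); last 2 first.
  + by apply: preproj_idealD => //; apply: preproj_idealZ.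
  + by apply: graded_graph_lin; apply: dP.
  exact: quot_pi_lin.
- rewrite (pid _ (p * d x)); last 2 first.
  + exact: preproj_idealMl.
  + by apply: graded_graph_mull; apply: dP.
  exact: quot_pi_mul.
- rewrite (pid _ (d x * p)); last 2 first.
  + exact: preproj_idealMr.
  + by apply: graded_graph_mulr; apply: dP.
  exact: quot_pi_mul.
- by rewrite (pid _ 1) //; [exact: preproj_elt_ideal | exact: graded_graph_rho].
Qed.

(** A derivation sends rho into the span of the paths of positive length modulo I,
    whereas the augmentation at a vertex sends 1 to 1. *)
Lemma HH2_preproj_neq0 : exists x : HH 2 (preproj_alg K Q), x != 0.
Proof.
have [D [DP DMl DMr Drho]] := relation_map.
apply: (HH2_neq0_of_ideal_map DP DMl DMr) => -[d [d_lin dM dD]].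
have [y yE] : exists y : arrow DQ -> P, forall a, quot_pi (@preproj_rel_proper K Q) (y a) = d (arr a).
  have [a|y yE] := @choice (arrow DQ) P (fun a x => quot_pi (@preproj_rel_proper K Q) x = d (arr a)).
    exact: quot_pi_surj.
  by exists y.
have dsum (J : finType) (F : J -> P) : d (\sum_j F j) = \sum_j d (F j).
  apply: (big_morph d) => [u v|]; last exact: linear_fun0 d_lin.
  by have := d_lin 1 u v; rewrite !scale1r.
pose t := \sum_b sgn b *: (y b * arr (star b) + arr b * y (star b)).
have Irt : I (1 - t).
  apply/(quot_pi_eq (@preproj_rel_proper K Q)).
  have := dD _ (@preproj_elt_ideal K Q); rewrite Drho rhoE dsum.
  move=> e; rewrite -[LHS]/(1 : quot_alg _) -e /t linear_sum; apply: eq_bigr => b _.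
  have dZ k x : d (k *: x) = k *: d x.
    by rewrite -[k *: x]addr0 d_lin (linear_fun0 d_lin) addr0.
  rewrite dZ dM linearZ; congr (_ *: _).
  by rewrite -!yE -!quot_pi_mul; apply/esym/raddfD.
have /card_gt0P[v _] := quiver_neq0 Q.
have a0 : aug v (0 : P) = 0 :> K by apply: mcoeff0.
have t0 : aug v t = 0 :> K.
  rewrite /t; elim/big_ind: _ => // [x z ex ez|b _].
    by rewrite -[x]scale1r augP ex ez mulr0 addr0.
  rewrite -[_ *: _]addr0 augP a0 -[y b * _]scale1r augP !augM !aug_arr.
  by rewrite mul0r !mulr0 !addr0 mulr0.
have a1 : aug v (1 : P) = 1 :> K.
  by have := augM v (1 : P) (idem v); rewrite mul1r aug_idem mulr1 => <-.
have := preproj_ideal_aug v Irt; rewrite addrC -scaleN1r augP t0 a1 mulr0 add0r => /eqP.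
by rewrite oner_eq0.
Qed.
End RelationMap.

(** * Harmonic weights on Euclidean diagrams *)

Section Delta.
Local Open Scope nat_scope.

Definition neighbour_sum (d : nat -> nat) (E : seq (nat * nat)) (i : nat) : nat :=
  \sum_(e <- E) ((e.1 == i) * d e.2 + (e.2 == i) * d e.1).

Definition harmonic (n : nat) (E : seq (nat * nat)) (d : nat -> nat) : Prop :=
  forall i, i < n -> 0 < d i /\ neighbour_sum d E i = 2 * d i.

Lemma neighbour_sum_line d m k i :
  neighbour_sum d [seq (j, j.+1) | j <- iota m k] i =
  (m <= i < m + k) * d i.+1 + (m < i <= m + k) * d i.-1.
Proof.
rewrite /neighbour_sum big_map big_split /=; congr (_ + _).
  elim: k m => [|k IH] m /=; first by rewrite big_nil; lia.
  rewrite big_cons IH; case: eqP => [->|ne]; lia.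
elim: k m => [|k IH] m /=; first by rewrite big_nil; lia.
rewrite big_cons IH; case: eqP => [<-|ne] /=; lia.
Qed.

(** The weights are the coefficients of the minimal positive imaginary root. *)
Lemma euclidean_harmonic n E : euclidean_diagram n E -> exists d, harmonic n E d.
Proof.
have scat d E1 E2 i : neighbour_sum d (E1 ++ E2) i = neighbour_sum d E1 i + neighbour_sum d E2 i.
  by rewrite /neighbour_sum big_cat.
have scons d e E1 i : neighbour_sum d (e :: E1) i =
    ((e.1 == i) * d e.2 + (e.2 == i) * d e.1) + neighbour_sum d E1 i.
  by rewrite /neighbour_sum big_cons.
have snil d i : neighbour_sum d [::] i = 0 by rewrite /neighbour_sum big_nil.
case=> [m m1|m m4||| ].
- exists (fun=> 1) => i im; split=> //.
  rewrite -cats1 scat neighbour_sum_line scons snil /=; lia.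
(* 1 on the four ends of the diagram, 2 elsewhere. *)
- pose d i := 2 - ((i < 2) + (m.-1 <= i)).
  exists d => i im; split; first by rewrite /d; lia.
  rewrite !(scat, scons, snil) neighbour_sum_line /=.
  have [d0 d1 d2] : [/\ d 0 = 1, d 1 = 1 & d 2 = 2] by rewrite /d; split; lia.
  have [e0 e1 e2] : [/\ d m = 1, d (m - 1) = 1 & d (m - 2) = 2] by rewrite /d; split; lia.
  rewrite d0 d1 d2 e0 e1 e2.
  have l1 : (2 <= i < 2 + (m - 4)) * d i.+1 = (2 <= i < 2 + (m - 4)) * 2.
    by rewrite /d; case: (boolP (2 <= i < 2 + (m - 4))) => h; lia.
  have l2 : (2 < i <= 2 + (m - 4)) * d i.-1 = (2 < i <= 2 + (m - 4)) * 2.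
    by rewrite /d; case: (boolP (2 < i <= 2 + (m - 4))) => h; lia.
  rewrite l1 l2 /d; lia.
- exists (nth 0 [:: 3; 2; 1; 2; 1; 2; 1]) => i im.
  by rewrite !(scons, snil); do 7?[case: i im => [|i] im //].
- exists (nth 0 [:: 4; 3; 2; 1; 3; 2; 1; 2]) => i im.
  by rewrite !(scons, snil); do 8?[case: i im => [|i] im //].
- exists (nth 0 [:: 6; 5; 4; 3; 2; 1; 4; 2; 3]) => i im.
  by rewrite !(scons, snil); do 9?[case: i im => [|i] im //].
Qed.

Lemma euclidean_delta (Q : quiver) : of_euclidean_type Q -> exists delta : vertex Q -> nat,
  (forall v, 0 < delta v) /\ forall v : vertex (double_quiver Q),
    \sum_(a : arrow (double_quiver Q) | src a == v) delta (tgt a) = 2 * delta v.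
Proof.
case=> n [E [/euclidean_harmonic[d dh] [f [g [bf bg fg]]]]].
exists (fun v => d (f v)); split=> v; first by case: (dh (f v) (ltn_ord _)).
have [_ <-] := dh (f v) (ltn_ord _).
rewrite big_mkcond big_sumType /= -big_split /= /neighbour_sum.
rewrite (big_nth (0, 0)) big_mkord (reindex g) /=; last exact: onW_bij.
apply: eq_bigr => a _.
have fE x y : (x == y :> vertex Q) = (val (f x) == val (f y)).
  by rewrite val_eqE (inj_eq (bij_inj bf)).
rewrite !fE; have [<-|<-] := fg a => /=; last rewrite addnC.
  by do 2!case: eqP => _; rewrite ?mul1n ?mul0n.
by do 2!case: eqP => _; rewrite ?mul1n ?mul0n.
Qed.
End Delta.

Theorem corollary4p6 (R : realType) (Q : quiver) (hQ : of_euclidean_type Q) :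
  exists x : HH 2%N (preproj_alg R[i] Q), x != 0.
Proof.
have [delta [delta_gt0 deltaE]] := euclidean_delta hQ.
apply: HH2_preproj_neq0 => n w.
exact: piece_growth delta_gt0 deltaE n w.
Qed.
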